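(* Assume $r\ge I\ge 2$. Then for every $\varepsilon>0$, $\mathbb P\big[Z_n^{(1)}=Z_n^{(2)}\big]=O\big((\log n)^{-2+\varepsilon}\big)$ as $n\to+\infty$, where $Z^{(1)},Z^{(2)}$ are recurrent random walks in the independent random environments $\omega^{(1)},\omega^{(2)}$, both started at $0$, and $\mathbb P$ is the annealed law.
   Context: Setting. On a probability space $(\Omega,\mathcal F,\mathsf P)$ (expectation $\mathsf E$) there are $r$ collections $\omega^{(j)}=(\omega^{(j)}_x)_{x\in\mathbb Z}$, $j\in\{1,\dots,r\}$, each made of i.i.d. random variables with values in $(0,1)$, such that $\omega^{(1)},\dots,\omega^{(I)}$ are independent and every other $\omega^{(j)}$ ($I<j\le r$) is an exact copy of one of them. With $\rho^{(j)}_k=(1-\omega^{(j)}_k)/\omega^{(j)}_k$, assume there is $\varepsilon_0\in(0,1/2)$ such that for every $j$: $\mathsf P[\omega^{(j)}_0\in[\varepsilon_0,1-\varepsilon_0]]=1$, $\mathsf E[\log\rho^{(j)}_0]=0$ and $\mathsf E[(\log\rho^{(j)}_0)^2]>0$. Given $\omega=(\omega^{(1)},\dots,\omega^{(r)})$, under the quenched law $P_\omega=P_\omega^0$ the processes $Z^{(1)},\dots,Z^{(r)}$ are independent Markov chains on $\mathbb Z$ started at $0$ with $P_\omega[Z^{(j)}_{n+1}=y+1\mid Z^{(j)}_n=y]=\omega^{(j)}_y=1-P_\omega[Z^{(j)}_{n+1}=y-1\mid Z^{(j)}_n=y]$. The annealed law is $\mathbb P[\cdot]=\int P_\omega[\cdot]\,\mathsf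 P(\mathrm d\omega)$. *)

(* Defs.v *)
From HB Require Import structures.
From mathcomp Require Import all_boot all_order all_algebra finmap.
From mathcomp Require Import all_classical all_reals all_analysis.

Set Implicit Arguments.
Unset Strict Implicit.
Unset Printing Implicit Defensive.

Import Order.TTheory GRing.Theory Num.Theory.
Import numFieldNormedType.Exports.

Local Open Scope classical_set_scope.
Local Open Scope ring_scope.

HB.instance Definition _ := isPointed.Build int 0.

(* The discrete sigma-algebra, as the library does for nat. *)
HB.instance Definition _ := @isMeasurable.Build default_measure_display
  int discrete_measurable discrete_measurable0
  discrete_measurableC discrete_measurableU.

Section Independence.
Context d (T : measurableType d) (R : realType).

Definition sigma_generated d' (T' : measurableType d') (K : Type)
    (X : K -> T -> T') : set (set T) :=
  <<s \bigcup_k preimage_set_system setT (X k) measurable >>.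

Definition independent (P : {measure set T -> \bar R}) (K : choiceType)
    (D : set K) (F : K -> set (set T)) : Prop :=
  forall (J : {fset K}) (A : K -> set T),
    [set` J] `<=` D -> (forall k, k \in J -> F k (A k)) ->
    P (\bigcap_(k in [set` J]) A k) = (\prod_(k <- J) P (A k))%E.

Definition independent_RVs (P : probability T R) (K : choiceType)
    (X : K -> {RV P >-> R}) : Prop :=
  independent P setT (fun k => preimage_set_system setT (X k) measurable).

Definition iid (P : probability T R) (K : choiceType)
    (X : K -> {RV P >-> R}) : Prop :=
  independent_RVs X /\
  (forall (k l : K) (B : set R), measurable B ->
     distribution P (X k) B = distribution P (X l) B).

End Independence.

Section MarkovChain.
Context d (T : measurableType d) (R : realType).
Variable P : {measure set T -> \bar R}.

(* The junk value when P B = 0 is never used: see markov_chain. *)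
Definition cond_prob (A B : set T) : R := fine (P (A `&` B)) / fine (P B).

Definition markov_chain (S : Type) (p : S -> S -> R) (x0 : S)
    (Z : nat -> T -> S) : Prop :=
  P [set t | Z 0 t = x0] = 1%E /\
  forall (n : nat) (y : nat -> S) (z : S),
    let past := [set t | forall k, (k <= n)%N -> Z k t = y k] in
    P past != 0%E ->
    cond_prob [set t | Z n.+1 t = z] past = p (y n) z.

End MarkovChain.

Section RandomEnvironment.
Variable R : realType.

Definition rho (a : R) : R := (1 - a) / a.

Definition walk_transition (omega : int -> R) (y z : int) : R :=
  if z == y + 1 then omega y
  else if z == y - 1 then 1 - omega y
  else 0.

Definition quenched_law d (W : measurableType d) (r : nat)
    (omega : 'I_r -> int -> R) (Z : 'I_r -> nat -> {mfun W >-> int})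
    (Q : {measure set W -> \bar R}) : Prop :=
  (forall j, markov_chain Q (walk_transition (omega j)) 0 (Z j)) /\
  independent Q setT (fun j => sigma_generated (Z j)).

(* Pq w is the quenched law P_omega for the environment omega drawn at the
   sample point w; A is an event about the walks only. *)
Definition annealed d d' (Omega : measurableType d) (W : measurableType d')
    (P : probability Omega R) (Pq : R.-pker Omega ~> W) (A : set W) : \bar R :=
  (\int[P]_w Pq w A)%E.

End RandomEnvironment.

(* Main.v *)
Require Import Defs.
From HB Require Import structures.
From mathcomp Require Import all_boot all_order all_algebra finmap.
From mathcomp Require Import all_classical all_reals all_analysis.
From mathcomp Require Import measurable_realfun zify ring lra.

(** Conditionally on the environments the walks are independent, and the two
environments are independent, so
[P(Z1_n = Z2_n) = sum_x E(p1_n(0,x)) E(p2_n(0,x))]; hence it suffices that,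
uniformly in [x], the quenched probability [p1_n(0,x)] exceeds
[C (log n)^-2] with probability [O((log n)^(-2+eps))].

Passages from [0] to [x] are split at the successive first passages from [y]
to [y+1].  By reversibility and spectral positivity, the laws of these
passages and the return probabilities to [x] decrease in time, and this gives
[p_n(0,x) <= C |x|^2 G_n(x,x) / n], where [G_n(x,x)] is the expected number of
visits to [x] up to time [n] for the walk started at [x].  If, on one side of
[x], the potential goes down by [c log log n] before going up by
[log n - c' log log n], then [G_n(x,x) <= n (log n)^-c''].  By optional stopping
this fails on a given side with probability [O(log log n / log n)], and the two
sides are independent, which squares the bound.  Sites further than
[(log n)^8] are out of reach, because the potential has to climb
[log n + 2 log log n] before reaching them. *)

Set Implicit Arguments.
Unset Strict Implicit.
Unset Printing Implicit Defensive.

Import Order.TTheory GRing.Theory Num.Theory.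
Import numFieldNormedType.Exports.

Local Open Scope classical_set_scope.
Local Open Scope ring_scope.

(** * Reversible birth-death chains *)

Section BirthDeath.
Variable R : realFieldType.
Implicit Types (a b f g pi : int -> R) (x y z : int) (n m N : nat).

(** Since [E(p2_n(0,x))] sums to one over [x], only the first walk has to be estimated, one fixed
    target [x] at a time. No union bound over sites is ever taken: the failure probability, of order
    [(log log n / log n)^2], would not survive a sum over a power of [log n] sites. The obstacle is
    that [p_n(0,x)] concerns a single time, whereas the potential controls sums over time such as
    [G_n(x,x)]. Monotonicity in time is what converts one into the other: a decreasing quantity at
    time [n] is at most its sum up to [n] divided by the number of terms. Every loss on the way
    (squared distance to [x], width of the valley) is a power of [log n]. On the scale of the
    potential it costs a multiple of [log log n], which in the exit problem is compared with a
    barrier of height about [log n]. The resulting factor [(log log n)^2] is what the exponent [eps]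
    absorbs. *)

Definition step a b f y : R := a y * f (y + 1) + b y * f (y - 1).

(** [hits a b n x y] is the probability that the (possibly killed) chain started
at [y] is at [x] at time [n]: the target comes first. *)
Definition hits a b n x : int -> R := iter n (step a b) (fun y => (y == x)%:R).

Arguments hits : simpl never.

Lemma hitsS a b n x y : hits a b n.+1 x y =
  a y * hits a b n x (y + 1) + b y * hits a b n x (y - 1).
Proof. by []. Qed.

Lemma hits_supp a b n x y : (n < `|y - x|)%N -> hits a b n x y = 0.
Proof.
elim: n y => [|n IH] y h; first by rewrite /hits /= (_ : y == x = false) //; lia.
by rewrite hitsS !IH ?mulr0 ?addr0 //; lia.
Qed.

Lemma hits_ge0 a b n x y : (forall z, 0 <= a z) -> (forall z, 0 <= b z) ->
  0 <= hits a b n x y.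
Proof.
move=> a0 b0; elim: n y => [|n IH] y; first by rewrite /hits /= ler0n.
by rewrite hitsS addr_ge0 // mulr_ge0.
Qed.

Lemma hits_le1 a b n x y : (forall z, 0 <= a z) -> (forall z, 0 <= b z) ->
  (forall z, a z + b z <= 1) -> hits a b n x y <= 1.
Proof.
move=> a0 b0 ab; elim: n y => [|n IH] y; first by rewrite /hits /= lern1 leq_b1.
rewrite hitsS; apply: le_trans (ab y).
by apply: lerD; rewrite -[leRHS]mulr1 ler_wpM2l.
Qed.

(** Finite windows replace sums over all integers. The walk has finite speed, so the functions
    involved vanish near both ends of a large window, and summation by parts leaves no boundary
    term. *)
Definition wsum N c f : R := \sum_(i < N) f (c + i%:Z).

Lemma wsum_shift N c f : f c = 0 -> f (c + N%:Z) = 0 ->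
  wsum N c (fun y => f (y + 1)) = wsum N c f.
Proof.
move=> h0 h1; apply/eqP; rewrite -subr_eq0 /wsum -sumrB.
rewrite -(big_mkord xpredT (fun i => f (c + i%:Z + 1) - f (c + i%:Z))).
rewrite (eq_bigr (fun i => (fun i => f (c + i%:Z)) i.+1 - (fun i => f (c + i%:Z)) i)).
  by rewrite telescope_sumr //= h1 addr0 h0 subrr.
by move=> i _ /=; congr (f _ - _); lia.
Qed.

Lemma wsum1 N c x f : (c <= x)%R -> (x < c + N%:Z)%R ->
  (forall y, y != x -> f y = 0) -> wsum N c f = f x.
Proof.
move=> h0 h1 h; have hx : (absz (x - c)%R < N)%N by lia.
rewrite /wsum (bigD1 (Ordinal hx)) //= big1 ?addr0; first by congr f; lia.
by move=> i /eqP hi; apply: h; apply/eqP => e; apply: hi; apply: val_inj => /=; lia.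
Qed.

(** * Self-adjointness, contraction and return probabilities *)

Section Reversible.
Variables a b pi : int -> R.
Hypotheses (a0 : forall y, 0 <= a y) (b0 : forall y, 0 <= b y).
Hypotheses (ab : forall y, a y + b y <= 1) (pi0 : forall y, 0 < pi y).
Hypothesis rev : forall y, pi y * a y = pi (y + 1) * b (y + 1).

Let dot N c f g := wsum N c (fun y => pi y * f y * g y).

Let vanish N c f := forall y, (y <= c + 1)%R || (c + N%:Z - 1 <= y)%R -> f y = 0.

Let rev' y : pi y * b y = pi (y - 1) * a (y - 1).
Proof. by rewrite rev subrK. Qed.

(** Detailed balance makes [step a b] self-adjoint for the weight [pi]; the margins required by
    [vanish] kill the boundary terms of the two shifts. *)
Let dot_step N c f g : vanish N c f -> vanish N c g ->
  dot N c (step a b f) g = dot N c f (step a b g).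
Proof.
move=> hf hg.
pose F y := pi y * b y * f y * g (y - 1).
pose G y := pi (y - 1) * a (y - 1) * f (y - 1) * g y.
transitivity (wsum N c (fun y => F (y + 1)) + wsum N c G).
  rewrite /wsum -big_split /=; apply: eq_bigr => i _.
  rewrite /F /G -rev -rev' /step addrK; ring.
rewrite wsum_shift; last 2 first.
- by rewrite /F hf ?mulr0 ?mul0r //; lia.
- by rewrite /F hf ?mulr0 ?mul0r //; lia.
rewrite -(@wsum_shift N c G); last 2 first.
- by rewrite /G hg ?mulr0 ?mul0r //; lia.
- by rewrite /G hg ?mulr0 ?mul0r //; lia.
rewrite /wsum -big_split /=; apply: eq_bigr => i _.
rewrite /F /G /step addrK; ring.
Qed.

(** Convexity of the square for the sub-probability weights [a y] and [b y] bounds the square of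
    [step a b f]; detailed balance then carries the weights back to [f], where they add up to at
    most one. *)
Let dot_step_le N c f : vanish N c f ->
  (forall y, (y <= c + 1 + 1)%R -> f y = 0) ->
  dot N c (step a b f) (step a b f) <= dot N c f f.
Proof.
move=> hf hf1.
pose F y := pi y * b y * f y * f y.
pose G y := pi (y - 1) * a (y - 1) * f (y - 1) * f (y - 1).
apply: (@le_trans _ _ (wsum N c (fun y => F (y + 1)) + wsum N c G)).
  rewrite /wsum -big_split /=; apply: ler_sum => i _.
  rewrite /F /G -rev -rev' /step; set y := c + _.
  have hp := pi0 y; move: (a0 y) (b0 y) (ab y).
  move: (a y) (b y) (f _) (f _) hp => A B v u; move: (pi y) => p hp hA hB hAB.
  have : (A * u + B * v) ^+ 2 <= A * u ^+ 2 + B * v ^+ 2.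
    have h1 : 0 <= A * B * (u - v) ^+ 2 by apply: mulr_ge0; [exact: mulr_ge0|exact: sqr_ge0].
    have h2 : 0 <= (1 - A - B) * (A * u ^+ 2 + B * v ^+ 2).
      apply: mulr_ge0; first lra.
      by apply: addr_ge0; apply: mulr_ge0; rewrite ?sqr_ge0.
    nra.
  by move=> h; have := ler_wpM2l (ltW hp) h; lra.
rewrite wsum_shift; last 2 first.
- by rewrite /F hf ?mulr0 ?mul0r //; lia.
- by rewrite /F hf ?mulr0 ?mul0r //; lia.
rewrite -(@wsum_shift N c G); last 2 first.
- by rewrite /G hf1 ?mulr0 ?mul0r //; lia.
- by rewrite /G hf ?mulr0 ?mul0r //; lia.
rewrite /wsum -big_split /=; apply: ler_sum => i _.
rewrite /F /G addrK; set y := c + _.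
have := ab y; have : 0 <= pi y * (f y * f y).
  by rewrite -expr2; apply: mulr_ge0; [exact: ltW|exact: sqr_ge0].
nra.
Qed.

Lemma hits_reversible n x y : pi x * hits a b n y x = pi y * hits a b n x y.
Proof.
(* The window has to contain all sites within reach in [n] steps, with the margin that [vanish] asks
   for. *)
pose M := (n + `|x - y| + 4)%N; pose N := (2 * M).+1; pose c := x - M%:Z.
have key k m : (k + m <= n)%N ->
    dot N c (hits a b k x) (hits a b m y) = dot N c (hits a b 0 x) (hits a b (k + m) y).
  elim: k m => [//|k IH] m h.
  rewrite addSnnS -IH; last by lia.
  apply: dot_step => z hz; apply: hits_supp; lia.
transitivity (dot N c (hits a b 0 x) (hits a b (n + 0) y)).
  rewrite /dot (@wsum1 _ _ x); [|lia|lia|].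
    by rewrite /hits /= eqxx mulr1 addn0.
  by move=> z /negbTE h; rewrite /hits /= h mulr0 mul0r.
rewrite -key ?addn0 // /dot (@wsum1 _ _ y); [|lia|lia|].
  by rewrite /hits /= eqxx mulr1.
by move=> z /negbTE h; rewrite [X in _ * X]/hits /= h mulr0.
Qed.

Let norm_hits M N c x m n : (m + n + 4 <= M)%N -> N = (2 * M).+1 -> c = x - M%:Z ->
  dot N c (hits a b m x) (hits a b n x) = pi x * hits a b (m + n) x x.
Proof.
move=> hM -> ->; elim: m n hM => [|m IH] n hM.
  rewrite /dot (@wsum1 _ _ x); [|lia|lia|].
    by rewrite /hits /= eqxx mulr1.
  by move=> z /negbTE h; rewrite [X in _ * X * _]/hits /= h mulr0 mul0r.
rewrite addSnnS -IH; last by lia.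
apply: dot_step => z hz; apply: hits_supp; lia.
Qed.

(* The return probability at time [m + m] is the squared norm, for [pi], of
   [hits a b m x], and [step] is a contraction. *)
Lemma hits_double_le m x : hits a b (m.+1 + m.+1) x x <= hits a b (m + m) x x.
Proof.
rewrite -(ler_pM2l (pi0 x)).
rewrite -(@norm_hits (m + m + 20) _ _ x m.+1 m.+1 _ erefl erefl); last lia.
rewrite -(@norm_hits (m + m + 20) _ _ x m m _ erefl erefl); last lia.
apply: dot_step_le => z hz; apply: hits_supp; lia.
Qed.

(** The return probability at time [m + m.+1] is the inner product of the functions at times [m] and
    [m.+1]. By [2uv <= u^2 + v^2] it is at most the mean of the return probabilities at the two
    adjacent even times, the later of which is the smaller. *)
Lemma hits_odd_le m x : hits a b (m + m.+1) x x <= hits a b (m + m) x x.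
Proof.
rewrite -(ler_pM2l (pi0 x)).
pose M := (m + m + 20)%N.
have h : dot (2 * M).+1 (x - M%:Z) (hits a b m x) (hits a b m.+1 x) *+ 2 <=
  dot (2 * M).+1 (x - M%:Z) (hits a b m x) (hits a b m x) +
  dot (2 * M).+1 (x - M%:Z) (hits a b m.+1 x) (hits a b m.+1 x).
  rewrite /dot /wsum -big_split -sumrMnl /=; apply: ler_sum => i _.
  set y := _ + _; have := pi0 y; move: (hits a b m.+1 x y) (hits a b m x y) => u v p0.
  have : 0 <= pi y * (u - v) ^+ 2 by apply: mulr_ge0; [exact: ltW|exact: sqr_ge0].
  rewrite mulr2n => hh. lra.
move: h; rewrite !(@norm_hits M _ _ x _ _ _ erefl erefl) /M; try lia.
have := ler_wpM2l (ltW (pi0 x)) (hits_double_le m x).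
rewrite mulr2n; lra.
Qed.

(** Among the times up to [m + m] there are [m.+1] even ones, each with a return probability at
    least the last one. Keeping only these costs the factor 2. *)
Lemma hits_return_le n x : n.+2%:R * hits a b n x x <= 2 * \sum_(k < n.+1) hits a b k x x.
Proof.
have mono m j : (j <= m)%N -> hits a b (m + m) x x <= hits a b (j + j) x x.
  move=> /subnK <-; elim: (m - j)%N => [//|i IH].
  exact: le_trans (hits_double_le _ _) IH.
have even m : m.+1%:R * hits a b (m + m) x x <= \sum_(k < (m + m).+1) hits a b k x x.
  have h0 j : 0 <= hits a b j x x by exact: hits_ge0.
  suff: \sum_(j < m.+1) hits a b (j + j) x x <= \sum_(k < (m + m).+1) hits a b k x x.
    apply: le_trans.
    rewrite mulr_natl -[X in _ *+ X](card_ord m.+1) -sumr_const; apply: ler_sum => i _.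
    by apply: mono; rewrite -ltnS.
  elim: m => [|m IH]; first by rewrite !big_ord1.
  rewrite addSn addnS (big_ord_recr m.+1) (big_ord_recr (m + m).+2) /=.
  rewrite (big_ord_recr (m + m).+1) /= -addrA lerD // addSn addnS.
  by rewrite ler_wpDl.
have h0 j : 0 <= hits a b j x x by exact: hits_ge0.
rewrite -(odd_double_half n) -addnn; case: (odd n).
  rewrite [nat_of_bool _]/= add1n big_ord_recr.
  have := even n./2; have := hits_odd_le n./2 x; rewrite addnS.
  rewrite [nat_of_ord _]/=; have := h0 (n./2 + n./2).+1.
  set H := hits _ _ _ _ _; set K := hits _ _ _ _ _ => hH HK he.
  have -> : (n./2 + n./2).+3%:R = 2 * n./2.+1%:R + 1 :> R.
    by rewrite -!natr1 natrD; ring.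
  move: he; have : (n./2.+1)%:R * H <= n./2.+1%:R * K by rewrite ler_wpM2l.
  move: (n./2.+1%:R) (\sum_(i < _) _) => c S h1 h2; rewrite [Monoid.Law.sort _ _ _]/=; lra.
rewrite [nat_of_bool _]/= add0n.
have -> : (n./2 + n./2).+2%:R = 2 * n./2.+1%:R :> R by rewrite -!natr1 natrD; ring.
by rewrite -mulrA ler_wpM2l.
Qed.

End Reversible.

Lemma hits_reflect a b a' b' n x y : (forall z, a' z = b (- z)) -> (forall z, b' z = a (- z)) ->
  hits a' b' n (- x) (- y) = hits a b n x y.
Proof.
move=> ha hb; elim: n y => [|n IH] y; first by rewrite /hits /= eqr_opp.
rewrite !hitsS ha hb !opprK addrC; congr (_ * _ + _ * _); rewrite -IH; congr hits; lia.
Qed.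

(** * The walk in a fixed environment *)

Section Walk.
Variable w : int -> R.
Hypothesis w01 : forall y, 0 < w y < 1.

Definition walk_prob n x y := hits w (fun y => 1 - w y) n x y.

Lemma walk_probS n x y : walk_prob n.+1 x y =
  w y * walk_prob n x (y + 1) + (1 - w y) * walk_prob n x (y - 1).
Proof. by []. Qed.

Let w0 y : 0 <= w y. Proof. by case/andP: (w01 y) => /ltW. Qed.
Let v0 y : 0 <= 1 - w y. Proof. by case/andP: (w01 y) => _ /ltW; rewrite subr_ge0. Qed.

Lemma walk_prob_ge0 n x y : 0 <= walk_prob n x y.
Proof. exact: hits_ge0. Qed.

Lemma walk_prob_le1 n x y : walk_prob n x y <= 1.
Proof. by apply: hits_le1 => // z; rewrite subrKC. Qed.

Lemma reversible_measure : exists pi, (forall y, 0 < pi y) /\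
  forall y, pi y * w y = pi (y + 1) * (1 - w (y + 1)).
Proof.
have wp y : 0 < w y by case/andP: (w01 y).
have vp y : 0 < 1 - w y by case/andP: (w01 y); rewrite subr_gt0.
(* On a line, detailed balance is a two-term recursion, solved from [pi 0 = 1] in both directions.
   [Negz n] stands for [- n - 1], hence [n.+1] factors. *)
pose pi z := match z with
  | Posz n => \prod_(k < n) (w k%:Z / (1 - w (k%:Z + 1)))
  | Negz n => \prod_(k < n.+1) ((1 - w (- k%:Z)) / w (- k%:Z - 1)) end.
exists pi; split=> [[] n|[] n] /=; try by apply: prodr_gt0 => k _; rewrite divr_gt0.
  rewrite addn1 big_ord_recr /=.
  by rewrite -mulrA divfK // lt0r_neq0.
rewrite big_ord_recr /= (_ : Negz n = - n%:Z - 1); last lia.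
rewrite -mulrA divfK ?lt0r_neq0 // subrK; congr (_ * _).
by case: n => [|n]; rewrite ?big_ord0 /pi /= ?big_ord0.
Qed.

(** * First passages from a site to its right neighbour *)

Section Passage.
Variables (pi : int -> R) (y : int).
Hypothesis pi0 : forall z, 0 < pi z.
Hypothesis rev : forall z, pi z * w z = pi (z + 1) * (1 - w (z + 1)).

(** Both weights also vanish above [y], so that detailed balance with the same [pi] holds on the
    whole line and the bounds for reversible chains apply to the killed walk. *)
Let a z := if (z < y)%R then w z else 0.
Let b z := if (z <= y)%R then 1 - w z else 0.
Let a0 z : 0 <= a z. Proof. by rewrite /a; case: ifP. Qed.
Let b0 z : 0 <= b z. Proof. by rewrite /b; case: ifP. Qed.
Let ab z : a z + b z <= 1.
Proof.
by rewrite /a /b; have := w0 z; have := v0 z; case: ifP => _; case: ifP => _; lra.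
Qed.
Let revab z : pi z * a z = pi (z + 1) * b (z + 1).
Proof.
rewrite /a /b (_ : (z + 1 <= y)%R = (z < y)%R); last lia.
by case: ifP; rewrite ?mulr0.
Qed.

(** [passage k z] is the probability that, started at [z <= y], the walk jumps
from [y] to [y + 1] for the first time at step [k + 1]; it comes from the walk
killed at [y + 1]. *)
Definition passage k z := hits a b k y z * w y.

Lemma passage_ge0 k z : 0 <= passage k z.
Proof. by rewrite mulr_ge0 // hits_ge0. Qed.

Lemma passageS k z : passage k.+1 z = a z * passage k (z + 1) + b z * passage k (z - 1).
Proof. by rewrite /passage hitsS mulrDl !mulrA. Qed.

Lemma passage0 z : passage 0 z = (z == y)%:R * w y.
Proof. by []. Qed.

(** On its way to [x] the walk has to jump from [y] to [y + 1]; when it first does so at step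
    [k + 1], [n.-1 - k] steps remain. *)
Lemma walk_prob_passage n x z : (z <= y)%R -> (y < x)%R ->
  walk_prob n x z = \sum_(k < n) passage k z * walk_prob (n.-1 - k) x (y + 1).
Proof.
move=> + hx; elim: n z => [|n IH] z hz.
  by rewrite big_ord0 /walk_prob /hits /= (_ : (z == x) = false) //; lia.
rewrite big_ord_recl walk_probS passage0 /= subn0.
have e : \sum_(i < n) passage (bump 0 i) z * walk_prob (n - bump 0 i) x (y + 1) =
  a z * (\sum_(i < n) passage i (z + 1) * walk_prob (n.-1 - i) x (y + 1)) +
  b z * (\sum_(i < n) passage i (z - 1) * walk_prob (n.-1 - i) x (y + 1)).
  rewrite !mulr_sumr -big_split /=; apply: eq_bigr => i _.
  rewrite /bump add1n passageS mulrDl !mulrA.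
  by rewrite (_ : (n - i.+1 = n.-1 - i)%N) //; have := ltn_ord i; lia.
rewrite e /a /b hz; have [->|/eqP hzy] := eqVneq z y.
  by rewrite ltxx mul1r mul0r add0r -IH //; lia.
have -> : (z < y)%R by lia.
by rewrite !mul0r add0r -!IH //; lia.
Qed.

Lemma passage_mass n z : (z <= y)%R -> \sum_(k < n) passage k z <= 1.
Proof.
elim: n z => [|n IH] z hz; first by rewrite big_ord0.
rewrite big_ord_recl passage0 /=.
rewrite (eq_bigr (fun i : 'I_n => a z * passage i (z + 1) + b z * passage i (z - 1))); last first.
  by move=> i _; rewrite /bump add1n passageS.
rewrite big_split -!mulr_sumr /= /a /b hz.
have h1 : \sum_(i < n) passage i (z - 1) <= 1 by apply: IH; lia.
have := ler_wpM2l (v0 z) h1.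
have [->|/eqP hzy] := eqVneq z y; first by rewrite ltxx mul1r mul0r add0r; lra.
have -> : (z < y)%R by lia.
rewrite mul0r add0r.
have h2 : \sum_(i < n) passage i (z + 1) <= 1 by apply: IH; lia.
have := ler_wpM2l (w0 z) h2; lra.
Qed.

(** A first passage started at [y] itself is a return of the killed walk to [y] followed by a jump.
    The return bound applies, and the sum on its right becomes a total passage probability, at most
    one. *)
Lemma passage_le k : k.+2%:R * passage k y <= 2.
Proof.
have := hits_return_le a0 b0 ab pi0 revab k y => /(ler_wpM2r (w0 y)).
have := passage_mass k.+1 (lexx y); rewrite /passage -mulr_suml.
move=> h1 h2; rewrite mulrA; apply: le_trans h2 _.
by rewrite -mulrA -[leRHS]mulr1 ler_wpM2l.
Qed.

End Passage.

(** * Truncated Green function and potential *)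

Definition green n x y := \sum_(k < n.+1) walk_prob k x y.

Lemma green0 x y : green 0 x y = (y == x)%:R.
Proof. by rewrite /green big_ord1. Qed.

Lemma greenS n x y : green n.+1 x y =
  (y == x)%:R + (w y * green n x (y + 1) + (1 - w y) * green n x (y - 1)).
Proof.
rewrite /green big_ord_recl !mulr_sumr -big_split; congr (_ + _).
Qed.

Lemma green_ge0 n x y : 0 <= green n x y.
Proof. by apply: sumr_ge0 => k _; exact: walk_prob_ge0. Qed.

Lemma green_mono n m x y : (n <= m)%N -> green n x y <= green m x y.
Proof.
move=> /subnK <-; elim: (m - n)%N => [//|k IH].
by apply: le_trans IH _; rewrite addSn [leRHS]/green big_ord_recr lerDl walk_prob_ge0.
Qed.

(** Visits to [x] can only be counted once [x] is reached, with less time left. The induction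
    separates the two horizons because first-step analysis shortens only the left one. *)
Lemma green_start_le n x y : (y <= x)%R -> green n x y <= green n x x.
Proof.
suff h N m z : (m <= N)%N -> (z <= x)%R -> green m x z <= green N x x by exact: h.
elim: m z => [|m IH] z hm hz.
  rewrite green0; apply: le_trans (green_mono x x hm).
  by rewrite green0 eqxx ler_nat leq_b1.
have [-> //|/eqP h] := eqVneq z x; first exact: green_mono.
rewrite greenS (_ : (z == x) = false); last lia.
rewrite add0r [leRHS](_ : _ = w z * green N x x + (1 - w z) * green N x x); last ring.
by apply: lerD; apply: ler_wpM2l => //; apply: IH; lia.
Qed.

Lemma sum_walk_prob_rev_le m x y :
  \sum_(k < m) walk_prob (m.-1 - k) x y <= green m x y.
Proof.
case: m => [|m]; first by rewrite big_ord0 green_ge0.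
rewrite (reindex_inj rev_ord_inj) /green [leRHS]big_ord_recr.
apply: ler_wpDr; first exact: walk_prob_ge0.
apply: ler_sum => i _ /=.
by rewrite (_ : (m - (m.+1 - i.+1) = i)%N) //; have := ltn_ord i; lia.
Qed.

(* In the first-passage decomposition either the passage to the next site or the
   remaining time is long; the weights [1 / d.+2] and [d.+1 / d.+2] keep the
   constant quadratic in the distance. *)
Lemma walk_prob_le_green N m x (d : nat) : (m <= N)%N ->
  m%:R * walk_prob m x (x - d%:Z) <= 2 * d.+1%:R ^+ 2 * green N x x.
Proof.
have [pi [pi0 rev]] := reversible_measure.
elim: d m => [|d IH] m hm.
  rewrite subr0 expr1n mulr1; apply: le_trans (ler_wpM2l _ (green_mono x x hm)) => //.
  apply: le_trans (hits_return_le w0 v0 _ pi0 rev m x); last by move=> z; rewrite subrKC.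
  by rewrite ler_wpM2r ?ler_nat ?walk_prob_ge0 //; lia.
set y := x - d.+1%:Z; have ey : y + 1 = x - d%:Z by rewrite /y; lia.
rewrite (@walk_prob_passage y m x y) //; last by rewrite /y; lia.
set g := green N x x; set f := fun k => passage y k y.
set P := fun k => walk_prob (m.-1 - k) x (y + 1).
have g0 : 0 <= g by exact: green_ge0.
pose D := 2 * d.+1%:R * d.+2%:R * g.
have key (k : 'I_m) : m%:R * (f k * P k) <= f k * D + 2 * d.+2%:R * P k.
  have f0 : 0 <= f k by exact: passage_ge0.
  have P0 : 0 <= P k by exact: walk_prob_ge0.
  have D0 : 0 <= D by rewrite !mulr_ge0.
  have [h|h] := leqP m (d.+2 * k.+2).
    have h1 : m%:R * f k <= 2 * d.+2%:R.
      apply: (@le_trans _ _ (d.+2%:R * (k.+2%:R * f k))).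
        by rewrite mulrA -natrM ler_wpM2r // ler_nat.
      by rewrite mulrC ler_wpM2r // (passage_le y pi0 rev).
    have := ler_wpM2r P0 h1; have := mulr_ge0 f0 D0; lra.
  have h1 : m%:R * P k <= D.
    have h2 := IH (m.-1 - k)%N; rewrite -ey -/(P k) -/g in h2.
    have {}h2 : (m.-1 - k)%:R * P k <= 2 * d.+1%:R ^+ 2 * g by apply: h2; lia.
    have h3 : m%:R * d.+1%:R <= d.+2%:R * (m.-1 - k)%:R :> R.
      by rewrite -!natrM ler_nat; have := ltn_ord k; nia.
    rewrite -(@ler_pM2r _ d.+1%:R) // /D.
    have := ler_wpM2r P0 h3; have := ler_wpM2l (ler0n R d.+2) h2; lra.
  have := ler_wpM2l f0 h1; have : 0 <= 2 * d.+2%:R * P k by rewrite !mulr_ge0.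
  lra.
rewrite mulr_sumr; apply: le_trans (ler_sum _ (fun k _ => key k)) _.
rewrite big_split /= -mulr_suml -mulr_sumr.
have h1 : \sum_(k < m) f k <= 1 by exact: passage_mass.
have h2 : \sum_(k < m) P k <= g.
  apply: le_trans (sum_walk_prob_rev_le m x (y + 1)) _.
  apply: le_trans (green_mono x x hm); apply: green_start_le; rewrite ey; lia.
have D0 : 0 <= D by rewrite !mulr_ge0.
have d0 : 0 <= 2 * d.+2%:R :> R by rewrite mulr_ge0.
(* The constants close up: [2 * d.+1 * d.+2 + 2 * d.+2 = 2 * d.+2 ^+ 2]. *)
have := ler_wpM2r D0 h1; have := ler_wpM2l d0 h2.
rewrite /D (_ : d.+1%:R = d.+2%:R - 1 :> R); last by rewrite -[d.+2%:R]natr1 addrK.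
lra.
Qed.

(** The exponential of the potential increment between [x] and [x + i]. *)
Definition expV x i := \prod_(k < i) ((1 - w (x + k.+1%:Z)) / w (x + k.+1%:Z)).

Lemma expV_gt0 x i : 0 < expV x i.
Proof.
by apply: prodr_gt0 => k _; case/andP: (w01 (x + k.+1%:Z)) => h1 h2; rewrite divr_gt0 // subr_gt0.
Qed.

Let expVS x i : expV x i.+1 * w (x + i.+1%:Z) = expV x i * (1 - w (x + i.+1%:Z)).
Proof.
rewrite /expV big_ord_recr /= -mulrA divfK // lt0r_neq0 //.
by case/andP: (w01 (x + i.+1%:Z)).
Qed.

(** [pi z * w z] is the conductance of the edge from [z] to [z + 1], so [expV x i] is the resistance
    of the edge at [x + i] relative to the edge at [x]. *)
Let pi_expV pi x i : (forall z, pi z * w z = pi (z + 1) * (1 - w (z + 1))) ->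
  pi (x + i%:Z) * w (x + i%:Z) * expV x i = pi x * w x.
Proof.
move=> rev; elim: i => [|i IH]; first by rewrite addr0 /expV big_ord0 mulr1.
rewrite -IH [in RHS]rev -mulrA [w _ * _]mulrC expVS (_ : x + i%:Z + 1 = x + i.+1%:Z); last lia.
ring.
Qed.

(* [w x * c + S j] is a supersolution of the equation [greenS] at [x + j], because [S] is
   harmonic for the walk at the right of [x]. *)
Lemma green_expV_le N x (Y : nat) :
  w x * green N x x <= \sum_(0 <= i < Y) expV x i + N.+1%:R * expV x Y.
Proof.
have [pi [pi0 rev]] := reversible_measure.
have wp z : 0 < w z by case/andP: (w01 z).
set c := green N x (x + Y%:Z).
pose S j := \sum_(j <= i < Y) expV x i.
have S0 j : 0 <= S j by apply: sumr_ge0 => i _; rewrite ltW ?expV_gt0.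
(* By reversibility, visits to [x] from [x + Y] are visits to [x + Y] from [x], at most [N.+1] of
   them, up to the ratio of the measures at the two sites. *)
have hc : w x * c <= N.+1%:R * expV x Y.
  rewrite -(ler_pM2l (pi0 (x + Y%:Z))).
  have -> : pi (x + Y%:Z) * (w x * c) =
      \sum_(k < N.+1) w x * (pi x * walk_prob k (x + Y%:Z) x).
    rewrite /c /green !mulr_sumr; apply: eq_bigr => k _.
    rewrite mulrCA; congr (_ * _).
    exact: (@hits_reversible w (fun y => 1 - w y) pi rev k (x + Y%:Z) x).
  apply: (@le_trans _ _ (\sum_(k < N.+1) w x * pi x)).
    apply: ler_sum => k _; rewrite ler_wpM2l // ler_piMr ?walk_prob_le1 //.
    exact: ltW.
  rewrite sumr_const card_ord -mulr_natl [w x * _]mulrC -(pi_expV x Y rev).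
  have /andP[_ /ltW h1] := w01 (x + Y%:Z).
  have h2 : 0 <= N.+1%:R * (pi (x + Y%:Z) * expV x Y).
    by rewrite !mulr_ge0 // ltW ?expV_gt0.
  have := ler_wpM2l h2 h1; lra.
(* [S 0] is the relative resistance between [x] and [x + Y]: it accounts for the visits to [x]
   before [x + Y] is reached, and [c] for the later ones. *)
have main n : (n <= N)%N ->
    (forall z, (z <= x)%R -> w x * green n x z <= w x * c + S 0%N) /\
    (forall j, (j <= Y)%N -> w x * green n x (x + j%:Z) <= w x * c + S j).
  have c0 : 0 <= w x * c by rewrite mulr_ge0 ?green_ge0.
  have SS j : (j < Y)%N -> S j = expV x j + S j.+1 by move=> h; rewrite /S big_ltn.
  have c1 j : (j <= Y)%N -> w x * (x + j%:Z == x)%:R <= w x * c + S j.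
    move=> hj; have [e|] := eqVneq (x + j%:Z) x; last by rewrite mulr0 addr_ge0.
    have -> : j = 0%N by lia.
    rewrite mulr1; have [hY|hY] := posnP Y.
      rewrite /c hY addr0 -[leLHS]mulr1 ler_wpDr // ler_wpM2l //.
      by apply: le_trans (green_mono x x (leq0n N)); rewrite green0 eqxx.
    rewrite SS // /expV big_ord0.
    by have /andP[_ /ltW h] := w01 x; have := S0 1%N; move: (S _) => s hs; lra.
  elim: n => [|n IH] hn.
    split=> [z hz|j hj]; last by rewrite green0; exact: c1.
    have /(le_trans _) : w x * (x + 0%:Z == x)%:R <= w x * c + S 0%N by exact: c1.
    by apply; rewrite green0 addr0 eqxx ler_wpM2l // ler_nat leq_b1.
  have {IH} [IH1 IH2] := IH (ltnW hn).
  have left z : (z <= x)%R -> w x * green n.+1 x z <= w x * c + S 0%N.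
    move=> hz; have h1 : w x * green n x (z - 1) <= w x * c + S 0%N by apply: IH1; lia.
    have [ez|/eqP hzx] := eqVneq z x; last first.
      have h2 : w x * green n x (z + 1) <= w x * c + S 0%N by apply: IH1; lia.
      rewrite greenS (_ : (z == x) = false) ?add0r; last lia.
      have := ler_wpM2l (w0 z) h2; have := ler_wpM2l (v0 z) h1; lra.
    have [Y0|Y0] := posnP Y.
      apply: ler_wpDr => //; apply: ler_wpM2l => //.
      by rewrite /c Y0 addr0 ez green_mono.
    (* [S] drops by one between [x] and [x + 1]; taken with probability [w x], this drop pays for
       the visit counted at [x], which has weight [w x]. *)
    have e0 : S 0%N = 1 + S 1%N by rewrite SS // /expV big_ord0.
    have h2 : w x * green n x (x + 1) <= w x * c + S 1%N := IH2 1%N Y0.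
    rewrite greenS ez eqxx (_ : true%:R = 1 :> R) //; rewrite ez in h1.
    have := ler_wpM2l (w0 x) h2; have := ler_wpM2l (v0 x) h1; rewrite !e0.
    move: (green n x _) (green n x _) (S _) => g1 g2 s; lra.
  split=> // j; rewrite leq_eqVlt => /predU1P[->|hj].
    by apply: ler_wpDr => //; rewrite ler_wpM2l // green_mono.
  case: j hj => [|j] hj; first by rewrite addr0 left.
  have h1 := IH2 j (ltnW (ltnW hj)); have h2 := IH2 j.+2 hj.
  rewrite greenS (_ : (x + j.+1%:Z == x) = false) ?add0r; last lia.
  rewrite (_ : x + j.+1%:Z + 1 = x + j.+2%:Z); last lia.
  rewrite (_ : x + j.+1%:Z - 1 = x + j%:Z); last lia.
  have e1 := SS j (ltnW hj); have e2 := SS j.+1 hj.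
  have e3 := expVS x j.
  have := ler_wpM2l (w0 (x + j.+1%:Z)) h2; have := ler_wpM2l (v0 (x + j.+1%:Z)) h1.
  rewrite e1 e2; move: e3.
  move: (green n x _) (green n x _) (S _) (expV _ _) (expV _ _) => g1 g2 s r1 r2 e3 h3 h4.
  lra.
have [_ /(_ 0%N (leq0n _))] := main N (leqnn N); rewrite addr0 /S => h.
by apply: le_trans h _; rewrite addrC lerD2l.
Qed.

(** A nearest-neighbour path from [z] to [x] passes through [j], and a probability of visiting is at
    most an expected number of visits. *)
Lemma walk_prob_le_visits n x j z : (z <= j)%R -> (j <= x)%R ->
  walk_prob n x z <= green n j z.
Proof.
move=> + hj; elim: n z => [|n IH] z hz.
  rewrite green0 /walk_prob /hits /= ler_nat.
  by have [e|] := eqVneq z x; rewrite ?leq0n // (_ : z == j) //; lia.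
have [->|/eqP hzj] := eqVneq z j.
  apply: le_trans (walk_prob_le1 _ _ _) _.
  by apply: le_trans (green_mono j j (leq0n _)); rewrite green0 eqxx.
rewrite greenS (_ : (z == j) = false) ?add0r; last lia.
by rewrite walk_probS; apply: lerD; apply: ler_wpM2l => //; apply: IH; lia.
Qed.

(** The way to [x] leads through [z + Y]. Reversing time, the expected visits from [z] to [z + Y]
    are those from [z + Y] to [z], at most [n.+1], times the ratio of the measures, which is small
    when the potential at [z + Y] is high. *)
Lemma walk_prob_expV_le n x z (Y : nat) : (z + Y%:Z <= x)%R ->
  w (z + Y%:Z) * expV z Y * walk_prob n x z <= n.+1%:R.
Proof.
move=> hx; have [pi [pi0 rev]] := reversible_measure.
set j := z + Y%:Z; have hg : walk_prob n x z <= green n j z.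
  by apply: walk_prob_le_visits => //; rewrite /j; lia.
have r0 : 0 <= w j * expV z Y by rewrite mulr_ge0 // ltW // expV_gt0.
apply: le_trans (ler_wpM2l r0 hg) _; rewrite -(ler_pM2l (pi0 j)).
have -> : pi j * (w j * expV z Y * green n j z) = \sum_(k < n.+1) pi z * w z * walk_prob k j z.
  by rewrite !mulrA pi_expV // /green mulr_sumr.
rewrite mulr_natr -[X in _ *+ X](card_ord n.+1) -sumr_const; apply: ler_sum => k _.
rewrite mulrAC [X in X * _](_ : _ = pi j * walk_prob k z j); last first.
  exact: (@hits_reversible w (fun y => 1 - w y) pi rev k z j).
have /andP[_ /ltW h1] := w01 z; rewrite -mulrA; apply: ler_piMr; first exact: ltW.
by rewrite mulr_ile1 ?walk_prob_ge0 ?walk_prob_le1.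
Qed.

End Walk.

(** The environment seen by the reflected walk; it transfers to the left what is proved at the right
    of a site. *)
Definition mirror (w : int -> R) z := 1 - w (- z).

Lemma mirror01 w : (forall y, 0 < w y < 1) -> forall y, 0 < mirror w y < 1.
Proof. by move=> h y; have := h (- y); rewrite /mirror => /andP[h1 h2]; apply/andP; split; lra. Qed.

Lemma walk_prob_mirror w n x y : walk_prob (mirror w) n (- x) (- y) = walk_prob w n x y.
Proof. by apply: hits_reflect => // z; rewrite /mirror subKr. Qed.

Lemma green_mirror w n x y : green (mirror w) n (- x) (- y) = green w n x y.
Proof. by apply: eq_bigr => k _; exact: walk_prob_mirror. Qed.

(** In terms of the potential measured from [x]: it falls to [ln alpha] within [N1] steps to the
    right, without having exceeded [ln beta] before. The walk is then drawn away from [x], which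
    keeps the Green function small. *)
Definition valley w x (N1 : nat) (alpha beta : R) := exists Y : nat,
  [/\ (Y <= N1)%N, expV w x Y <= alpha & forall i, (i < Y)%N -> expV w x i <= beta].

Section Bounds.
Variables (w : int -> R) (e : R).
Hypotheses (e0 : 0 < e) (we : forall y, e <= w y <= 1 - e).

Let w01 y : 0 < w y < 1.
Proof. by case/andP: (we y) => h1 h2; move: e0 => e0'; apply/andP; split; lra. Qed.

Lemma green_valley_le N x N1 alpha beta : 0 <= beta -> valley w x N1 alpha beta ->
  e * green w N x x <= N1%:R * beta + N.+1%:R * alpha.
Proof.
move=> beta0 [Y [hY ha hb]].
have /andP[h1 _] := we x.
apply: le_trans (ler_wpM2r (green_ge0 w01 N x x) h1) _.
apply: le_trans (green_expV_le w01 N x Y) _.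
apply: lerD; last by rewrite ler_wpM2l.
apply: (@le_trans _ _ (Y%:R * beta)); last by rewrite ler_wpM2r // ler_nat.
rewrite mulr_natl -[X in _ *+ X](card_ord Y) -sumr_const big_mkord.
by apply: ler_sum => i _; exact: hb.
Qed.

End Bounds.

Lemma mirror_bounds w e : (forall y, e <= w y <= 1 - e) -> forall y, e <= mirror w y <= 1 - e.
Proof.
by move=> h y; have /andP[] := h (- y); rewrite /mirror => h1 h2; apply/andP; split; lra.
Qed.

Lemma walk_prob_valley_le w e n x N1 alpha beta : 0 < e ->
  (forall y, e <= w y <= 1 - e) -> 0 <= beta ->
  valley w x N1 alpha beta \/ valley (mirror w) (- x) N1 alpha beta ->
  e * n%:R * walk_prob w n x 0 <= 2 * (`|x|%N).+1%:R ^+ 2 * (N1%:R * beta + n.+1%:R * alpha).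
Proof.
move=> e0 we beta0 hv.
have w01 y : 0 < w y < 1 by have /andP[h1 h2] := we y; apply/andP; split; lra.
have hg : e * green w n x x <= N1%:R * beta + n.+1%:R * alpha.
  case: hv => [|hv]; first exact: green_valley_le.
  by rewrite -green_mirror; apply: green_valley_le => //; exact: mirror_bounds.
have h1 : n%:R * walk_prob w n x 0 <= 2 * (`|x|%N).+1%:R ^+ 2 * green w n x x.
  (* The side of the valley and the side of the origin, both seen from [x], are unrelated, so the
     reflection is used separately for each. *)
  case: x {hv hg} => x.
    by have := walk_prob_le_green w01 x x (leqnn n); rewrite subrr.
  rewrite -green_mirror -walk_prob_mirror oppr0.
  have := walk_prob_le_green (mirror01 w01) (- Negz x) x.+1 (leqnn n).
  by rewrite (_ : - Negz x - x.+1%:Z = 0) //; lia.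
rewrite -mulrA; apply: le_trans (ler_wpM2l (ltW e0) h1) _.
rewrite mulrCA; apply: ler_wpM2l hg.
by apply: mulr_ge0 => //; exact: exprn_ge0.
Qed.

Lemma walk_prob_far_le w e n x (Y : nat) gamma : 0 < e ->
  (forall y, e <= w y <= 1 - e) -> 0 <= gamma -> (Y <= `|x|)%N ->
  ((0 <= x)%R -> gamma <= expV w 0 Y) -> ((x <= 0)%R -> gamma <= expV (mirror w) 0 Y) ->
  e * gamma * walk_prob w n x 0 <= n.+1%:R.
Proof.
move=> e0 we g0 hY hr hl.
have key w' z : (forall y, e <= w' y <= 1 - e) -> (0 <= z)%R -> (Y <= `|z|)%N ->
    gamma <= expV w' 0 Y -> e * gamma * walk_prob w' n z 0 <= n.+1%:R.
  move=> we' z0 hz hg; have /andP[h1 _] := we' (0 + Y%:Z).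
  have w01 y : 0 < w' y < 1 by have /andP[h2 h3] := we' y; apply/andP; split; lra.
  apply: le_trans (@walk_prob_expV_le w' w01 n z 0 Y _); last lia.
  apply: ler_wpM2r; first exact: walk_prob_ge0.
  by apply: ler_pM => //; exact: ltW.
have [hx|hx] := leP 0%R x; first by apply: key => //; exact: hr.
rewrite -walk_prob_mirror oppr0; apply: key; [exact: mirror_bounds|lia|lia|].
by apply: hl; exact: ltW.
Qed.

End BirthDeath.

(** * Independence and bounded expectations *)

Section IndependentBlocks.
Context d (T : measurableType d) (R : realType) (P : probability T R).
Variables (K : choiceType) (F : K -> set (set T)).
Hypotheses (FI : forall k, setI_closed (F k)) (FT : forall k, F k setT).
Hypothesis Fm : forall k, F k `<=` measurable.
Hypothesis Findep : independent P setT F.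

(** Cylinders are given by total families that are trivial outside a finite set, so that
    intersections are taken pointwise even when the finite sets differ. *)
Let cyl (D : set K) : set (set T) := [set A | exists (J : {fset K}) (a : K -> set T),
  [/\ forall k, F k (a k), forall k, k \notin J -> a k = setT,
      forall k, ~ D k -> a k = setT & A = [set t | forall k, a k t]]].

Let cylE (J : {fset K}) (a : K -> set T) : (forall k, F k (a k)) ->
  (forall k, k \notin J -> a k = setT) ->
  P [set t | forall k, a k t] = (\prod_(k <- J) P (a k))%E.
Proof.
move=> Fa aJ; rewrite -Findep //; congr (P _); apply/seteqP; split=> t /= h k.
  by move=> _; exact: h.
have [kJ|kJ] := boolP (k \in J); first exact: h.
by rewrite aJ.
Qed.

Let cylI D : setI_closed (cyl D).
Proof.
move=> _ _ [J [a [Fa aJ aD ->]]] [J' [a' [Fa' aJ' aD' ->]]].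
exists (J `|` J')%fset, (fun k => a k `&` a' k); split.
- by move=> k; exact: FI.
- by move=> k; rewrite inE negb_or => /andP[h h']; rewrite aJ // aJ' // setIT.
- by move=> k h; rewrite aD // aD' // setIT.
- apply/seteqP; split=> t /=; first by move=> [h h'] k.
  by move=> h; split=> k; have [] := h k.
Qed.

Let cylT D : cyl D setT.
Proof.
exists fset0, (fun=> setT); split=> //.
by apply/seteqP; split=> t.
Qed.

Let cylm D : cyl D `<=` measurable.
Proof.
move=> _ [J [a [Fa aJ aD ->]]].
rewrite (_ : [set t | _] = \bigcap_(k in [set` J]) a k).
  by apply: fin_bigcap_measurable => // k _; exact/Fm/Fa.
apply/seteqP; split=> t /= h k; first by move=> _; exact: h.
by have [kJ|kJ] := boolP (k \in J); [exact: h|rewrite aJ].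
Qed.

Let cyl_indep D1 D2 A B : D1 `&` D2 = set0 -> cyl D1 A -> cyl D2 B ->
  P (A `&` B) = (P A * P B)%E.
Proof.
move=> D12 [J [a [Fa aJ aD ->]]] [J' [a' [Fa' aJ' aD' ->]]].
pose L := (J `|` J')%fset.
have aL k : k \notin L -> a k = setT by rewrite inE negb_or => /andP[h _]; exact: aJ.
have aL' k : k \notin L -> a' k = setT by rewrite inE negb_or => /andP[_ h]; exact: aJ'.
rewrite (cylE Fa aL) (cylE Fa' aL') -big_split /=.
rewrite (_ : _ `&` _ = [set t | forall k, (a k `&` a' k) t]); last first.
  apply/seteqP; split=> t /=; first by move=> [h h'] k.
  by move=> h; split=> k; have [] := h k.
rewrite (@cylE L) //; last 2 first.
- by move=> k; exact: FI.
- by move=> k kL; rewrite aL // aL' // setIT.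
apply: eq_bigr => k _; have [h|h] := pselect (D1 k).
  have -> : a' k = setT by apply: aD' => h'; have : (D1 `&` D2) k by []; rewrite D12.
  by rewrite setIT probability_setT mule1.
by rewrite (aD k h) setTI probability_setT mul1e.
Qed.

(** Restriction of [P] to [B] and multiplication of [P] by [P B] are two finite measures that agree
    on a pi-system, hence on the sigma-algebra it generates. *)
Let P_indep (D1 : set (set T)) B : measurable B -> setI_closed D1 -> D1 setT ->
  D1 `<=` measurable -> (forall A, D1 A -> P (A `&` B) = (P A * P B)%E) ->
  forall A, <<s D1 >> A -> P (A `&` B) = (P A * P B)%E.
Proof.
move=> mB D1I D1T D1m h A DA.
have hB : 0 <= fine (P B) by rewrite fine_ge0.
have scE C : mscale (NngNum hB) P C = (P C * P B)%E.
  by rewrite /mscale /= fineK ?fin_num_measure // muleC.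
suff : mrestr P mB A = mscale (NngNum hB) P A by rewrite scE.
apply: (g_sigma_algebra_measure_unique D1 D1m (fun=> setT)) => //.
- by rewrite bigcup_const //; exists 0%N.
- by move=> C DC; apply: etrans (h _ DC) (esym (scE C)).
- by move=> _; rewrite /= /mrestr setTI ltey_eq fin_num_measure.
Qed.

Lemma independent_blocks (D1 D2 : set K) A B : D1 `&` D2 = set0 ->
  <<s \bigcup_(k in D1) F k >> A -> <<s \bigcup_(k in D2) F k >> B ->
  P (A `&` B) = (P A * P B)%E.
Proof.
move=> D12.
have sub D : <<s \bigcup_(k in D) F k >> `<=` <<s cyl D >>.
  apply: sub_sigma_algebra2 => C [k Dk FC].
  exists [fset k]%fset, (fun j => if j == k then C else setT); split.
  - by move=> j; case: eqP => [->|].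
  - by move=> j; rewrite inE => /negbTE ->.
  - by move=> j Dj; case: eqP Dj => // ->.
  - apply/seteqP; split=> t /= h; last by have := h k; rewrite eqxx.
    by move=> j; case: eqP.
have cm D C : <<s cyl D >> C -> measurable C.
  by apply: smallest_sub; [exact: sigma_algebra_measurable|exact: cylm].
move=> /sub hA /sub hB; move: A hA.
apply: P_indep; [exact: cm hB|exact: cylI|exact: cylT|exact: cylm|] => A hA.
rewrite setIC muleC; move: B hB.
apply: P_indep; [exact: cylm hA|exact: cylI|exact: cylT|exact: cylm|] => B hB.
by rewrite setIC muleC; exact: cyl_indep hA hB.
Qed.

End IndependentBlocks.

Section BoundedExpectation.
Context d (T : measurableType d) (R : realType) (P : probability T R).
Implicit Types (f g : T -> R) (A : set T).

Definition bddm f := measurable_fun setT f /\ exists M, forall t, `|f t| <= M.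

Definition Ex f : R := (\int[P]_t f t)%R.

Lemma bddm_integrable f : bddm f -> P.-integrable setT (EFin \o f).
Proof.
move=> [mf [M hM]]; apply: measurable_bounded_integrable => //; first by rewrite fin_num_fun_lty.
exists M; split; first exact: num_real.
by move=> x xM t _; apply: le_trans (hM t) (ltW xM).
Qed.

Lemma bddm_cst c : bddm (fun=> c).
Proof. by split; [exact: measurable_cst|exists `|c|]. Qed.

Lemma bddmD f g : bddm f -> bddm g -> bddm (fun t => f t + g t).
Proof.
move=> [mf [M hM]] [mg [M' hM']]; split; first exact: measurable_funD.
by exists (M + M') => t; apply: le_trans (ler_normD _ _) _; exact: lerD.
Qed.

Lemma bddmM f g : bddm f -> bddm g -> bddm (fun t => f t * g t).
Proof.
move=> [mf [M hM]] [mg [M' hM']]; split; first exact: measurable_funM.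
by exists (M * M') => t; rewrite normrM; exact: ler_pM.
Qed.

Lemma bddm_indic A : measurable A -> bddm (\1_A).
Proof.
move=> mA; split; first exact: measurable_indic.
by exists 1 => t; rewrite indicE ger0_norm // lern1 leq_b1.
Qed.

Lemma ExD f g : bddm f -> bddm g -> Ex (fun t => f t + g t) = Ex f + Ex g.
Proof. by move=> hf hg; rewrite /Ex RintegralD //; exact: bddm_integrable. Qed.

Lemma ExZ c f : bddm f -> Ex (fun t => c * f t) = c * Ex f.
Proof. by move=> hf; rewrite /Ex RintegralZl //; exact: bddm_integrable. Qed.

Lemma Ex_cst c : Ex (fun=> c) = c.
Proof. by rewrite /Ex Rintegral_cst //= probability_setT /= mulr1. Qed.

Lemma Ex_indic A : measurable A -> Ex (\1_A) = fine (P A).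
Proof. by move=> mA; rewrite /Ex /Rintegral integral_indic // setIT. Qed.

Lemma le_Ex f g : bddm f -> bddm g -> (forall t, f t <= g t) -> Ex f <= Ex g.
Proof.
by move=> hf hg fg; rewrite /Ex; apply: le_Rintegral => //; exact: bddm_integrable.
Qed.

(** Independence identifies the joint law of [(f, g)] with the product of the two laws; the rest is
    the Fubini theorem on the plane. *)
Lemma ExM_independent (F1 F2 : set (set T)) f g : bddm f -> bddm g ->
  (forall B, measurable B -> F1 (f @^-1` B)) ->
  (forall B, measurable B -> F2 (g @^-1` B)) ->
  (forall A B, F1 A -> F2 B -> P (A `&` B) = (P A * P B)%E) ->
  Ex (fun t => f t * g t) = Ex f * Ex g.
Proof.
move=> hf hg Ff Fg F12; have [mf [M hM]] := hf; have [mg [M' hM']] := hg.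
pose f' : {mfun T >-> R} := HB.pack f (isMeasurableFun.Build _ _ _ _ f mf).
pose g' : {mfun T >-> R} := HB.pack g (isMeasurableFun.Build _ _ _ _ g mg).
have mh : measurable_fun setT (fun t => (f t, g t)) by exact/measurable_fun_pair.
pose h : {mfun T >-> (R * R)%type} :=
  HB.pack (fun t => (f t, g t)) (isMeasurableFun.Build _ _ _ _ (fun t => (f t, g t)) mh).
pose F (z : R * R) : \bar R := (z.1 * z.2)%:E.
have mF : measurable_fun setT F.
  apply/measurable_EFinP; apply: measurable_funM; [exact: measurable_fst|exact: measurable_snd].
have iF : P.-integrable (h @^-1` setT) (F \o h).
  by rewrite preimage_setT; exact: (bddm_integrable (bddmM hf hg)).
have mh' := @measurable_funPT _ _ _ _ h.
have iF' := @integrable_pushforward _ _ _ _ _ h mh' P _ F mF iF measurableT.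
have e : forall X, measurable X ->
    (distribution P f' \x distribution P g')%E X = distribution P h X.
  apply: product_measure_unique => A B mA mB.
  rewrite /distribution /pushforward -F12; [|exact: Ff|exact: Fg].
  by congr (P _); apply/seteqP; split.
have iFp : (distribution P f' \x distribution P g')%E.-integrable setT F.
  apply/integrableP; split=> //; move/integrableP : iF' => [_].
  rewrite (eq_measure_integral (distribution P f' \x distribution P g')%E) // => A mA _.
  exact/esym/e.
have e1 : (\int[P]_t (f t * g t)%:E = \int[distribution P f' \x distribution P g']_z F z)%E.
  transitivity (\int[distribution P h]_z F z)%E.
    by rewrite (@integral_pushforward _ _ _ _ _ h mh' P _ F mF iF measurableT) preimage_setT.
  by apply: eq_measure_integral => A mA _; exact/esym/e.
have EE (k : {mfun T >-> R}) : bddm k -> (\int[distribution P k]_x x%:E = (Ex k)%:E)%E.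
  move=> hk; have ik : P.-integrable (k @^-1` setT) (EFin \o k).
    by rewrite preimage_setT; exact: bddm_integrable.
  have mE : measurable_fun setT (@EFin R) by exact/measurable_EFinP.
  have mk := @measurable_funPT _ _ _ _ k.
  rewrite (@integral_pushforward _ _ _ _ _ k mk P setT EFin mE ik measurableT).
  rewrite preimage_setT /Ex /Rintegral fineK //.
  exact: integrable_fin_num (bddm_integrable hk).
rewrite [LHS]/Ex /Rintegral e1 -integral12_prod_meas1 //.
have ik (k : {mfun T >-> R}) : bddm k -> (distribution P k).-integrable setT (@EFin R).
  move=> hk; apply: (@integrable_pushforward _ _ _ _ _ k (@measurable_funPT _ _ _ _ k)) => //.
  by rewrite preimage_setT; exact: bddm_integrable.
rewrite (eq_integral (fun x : R => x%:E * (Ex g)%:E)%E); last first.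
  move=> x _; rewrite -(EE g' hg) -integralZl //; exact: ik.
by rewrite integralZr ?(EE f' hf) // ; exact: ik.
Qed.

End BoundedExpectation.

(** * Exit of a random walk from an interval *)

Section StoppedWalk.
Variables (R : realType) (A B : R).

(** The walk with steps [y], frozen when it leaves the interval [`]- A, B[]. *)
Fixpoint stopped (y : nat -> R) k : R := if k is k'.+1
  then stopped y k' + \1_(`]- A, B[%classic) (stopped y k') * y k' else 0.

Lemma stopped_exit y n : 0 < A -> 0 < B -> stopped y n <= - A ->
  exists2 k, (k <= n)%N &
    \sum_(i < k) y i <= - A /\ forall j, (j < k)%N -> \sum_(i < j) y i < B.
Proof.
move=> A0 B0; pose S k := \sum_(i < k) y i.
(* Either the walk has not left the interval before time [m], or it is frozen at its value at the
   exit time [k]. *)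
have key m : (stopped y m = S m /\ forall j, (j < m)%N -> S j < B) \/
    (exists2 k, (k <= m)%N & [/\ stopped y m = S k, ~~ (- A < S k < B) &
       forall j, (j < k)%N -> S j < B]).
  elim: m => [|m [[IH1 IH2]|[k km [IH1 IH2 IH3]]]].
  - by left; rewrite /S big_ord0.
  - rewrite /= IH1; have [h|h] := boolP (- A < S m < B).
      have -> : \1_(`]- A, B[%classic) (S m) = 1 :> R.
        by rewrite indicE mem_set //= in_itv.
      left; rewrite mul1r /S big_ord_recr; split=> // j.
      rewrite ltnS leq_eqVlt => /predU1P[->|]; last exact: IH2.
      by case/andP: h.
    right; exists m => //; split=> //.
    by rewrite indicE memNset ?mul0r ?addr0 //= in_itv /=; exact/negP.
  - right; exists k; first exact: leqW.
    split=> //=; rewrite IH1 indicE memNset ?mul0r ?addr0 //= in_itv /=.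
    exact/negP.
case: (key n) => [[e h]|[k kn [e _ h]]]; rewrite e => hA.
  by exists n.
by exists k.
Qed.

Lemma stopped_bounds y n M : 0 < A -> 0 < B -> (forall i, `|y i| <= M) ->
  - (A + M) <= stopped y n <= B + M.
Proof.
move=> A0 B0 hM; have M0 : 0 <= M := le_trans (normr_ge0 _) (hM 0%N).
elim: n => [|n /= IH]; first by apply/andP; split=> /=; lra.
have /ler_normlP[h1 h2] := hM n.
have [h|h] := boolP (stopped y n \in (`]- A, B[%classic : set R)); rewrite indicE.
  rewrite h mul1r; move: h; rewrite inE /= in_itv /= => /andP[h3 h4].
  by apply/andP; split; lra.
by rewrite (negbTE h) mul0r addr0.
Qed.

Lemma indic_stopped_antitone y n :
  \1_(`]- A, B[%classic) (stopped y n.+1) <= \1_(`]- A, B[%classic) (stopped y n) :> R.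
Proof.
have [h|h] := boolP (stopped y n \in (`]- A, B[%classic : set R)).
  by rewrite [leRHS]indicE h indicE ler_nat leq_b1.
have e : \1_(`]- A, B[%classic) (stopped y n) = 0 :> R by rewrite indicE (negbTE h).
by rewrite /= e mul0r addr0 e.
Qed.

Context d (T : measurableType d) (P : probability T R).
Variables (Y : nat -> T -> R) (G : nat -> set (set T)) (M s2 : R).
Hypotheses (A0 : 0 < A) (B0 : 0 < B) (s20 : 0 < s2).
Hypothesis mY : forall k, measurable_fun setT (Y k).
Hypothesis YM : forall k t, `|Y k t| <= M.
Hypothesis Y0 : forall k, Ex P (Y k) = 0.
Hypothesis Y2 : forall k, Ex P (fun t => Y k t ^+ 2) = s2.
Hypothesis GY : forall k i C, (i < k)%N -> measurable C -> <<s G k >> (Y i @^-1` C).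
Hypothesis Gindep : forall k C D, <<s G k >> C -> measurable D ->
  P (C `&` Y k @^-1` D) = (P C * P (Y k @^-1` D))%E.

Let X k t := stopped (Y^~ t) k.

(** The source space is arbitrary because the lemma is also applied to [T] with the sigma-algebra of
    the past, where it says that the stopped walk is adapted. *)
Lemma measurable_stopped d' (T' : measurableType d') (Z : nat -> T' -> R) k :
  (forall i, (i < k)%N -> measurable_fun setT (Z i)) ->
  measurable_fun setT (fun t => stopped (Z^~ t) k).
Proof.
elim: k => [|k IH] mZ; first exact: measurable_cst.
have mS : measurable_fun setT (fun t => stopped (Z^~ t) k).
  by apply: IH => i ik; apply: mZ; exact: ltnW.
apply: measurable_funD => //; apply: measurable_funM; last exact: mZ.
by apply: (measurableT_comp _ mS); exact: measurable_indic.
Qed.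

Let bX k : bddm (X k).
Proof.
split; first by apply: measurable_stopped => i _; exact: mY.
exists (A + B + M) => t; have := @stopped_bounds (Y^~ t) k M A0 B0 (YM^~ t).
rewrite -/(X k t) => /andP[h1 h2]; apply/ler_normlP; split; move: A0 B0 h1 h2; lra.
Qed.

Let bY k : bddm (Y k).
Proof. by split => //; exists M. Qed.

Let ind := (\1_(`]- A, B[%classic) : R -> R).

Let mind : measurable_fun setT ind.
Proof. exact: measurable_indic. Qed.

Let bind k : bddm (fun t => ind (X k t)).
Proof.
split; first by apply: (measurableT_comp mind); case: (bX k).
by exists 1 => t; rewrite /ind indicE ger0_norm // lern1 leq_b1.
Qed.

Let GX k (f : R -> R) C : measurable_fun setT f -> measurable C ->
  <<s G k >> ((fun t => f (X k t)) @^-1` C).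
Proof.
move=> mf mC.
pose T' : measurableType (G k).-sigma := g_sigma_algebraType (G k).
have mX : measurable_fun setT (X k : T' -> R).
  apply: (@measurable_stopped _ T') => i ik _ D mD.
  by rewrite setTI; exact: GY.
have := measurableT_comp mf mX measurableT mC.
by rewrite setTI.
Qed.

Let ExXY k (f g : R -> R) : measurable_fun setT f -> measurable_fun setT g ->
  bddm (fun t => f (X k t)) -> bddm (fun t => g (Y k t)) ->
  Ex P (fun t => f (X k t) * g (Y k t)) = Ex P (fun t => f (X k t)) * Ex P (fun t => g (Y k t)).
Proof.
move=> mf mg bf bg.
apply: (@ExM_independent _ _ _ _ <<s G k >> (preimage_set_system setT (Y k) measurable)) => //.
- by move=> C mC; exact: GX.
- move=> C mC; exists (g @^-1` C); last by rewrite setTI.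
  by rewrite -[X in measurable X]setTI; exact: mg.
- by move=> C _ hC [D mD <-]; rewrite setTI; exact: Gindep.
Qed.

Let ExX k : Ex P (X k) = 0.
Proof.
elim: k => [|k IH]; first exact: Ex_cst.
rewrite (_ : X k.+1 = fun t => X k t + ind (X k t) * Y k t) //.
rewrite ExD ?IH //; last exact: bddmM.
by rewrite (@ExXY k ind id) // Y0 mulr0 addr0.
Qed.

Let e k := Ex P (fun t => ind (X k t)).

Let ExX2 k : Ex P (fun t => X k.+1 t ^+ 2) = Ex P (fun t => X k t ^+ 2) + e k * s2.
Proof.
have bind2 := bind k; have bXk := bX k; have bYk := bY k.
have bX2 : bddm (fun t => X k t ^+ 2) by exact: (bddmM bXk bXk).
have bY2 : bddm (fun t => Y k t ^+ 2) by exact: (bddmM bYk bYk).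
have bXi : bddm (fun t => X k t * ind (X k t)) by exact: bddmM.
have mXi : measurable_fun setT (fun x : R => x * ind x) by exact: measurable_funM.
have -> : (fun t => X k.+1 t ^+ 2) = fun t => X k t ^+ 2 +
    (2 * (X k t * ind (X k t) * Y k t) + ind (X k t) * Y k t ^+ 2).
  apply/funext => t; rewrite {1}/X /= -/(X k t) -/ind.
  have : ind (X k t) ^+ 2 = ind (X k t).
    by rewrite /ind indicE; case: (_ \in _); rewrite ?expr1n ?expr0n.
  by move=> h; rewrite sqrrD exprMn h; ring.
have b1 := bddmM bXi bYk; have b2 := bddmM bind2 bY2.
rewrite ExD // ?ExD // ?ExZ //; last 2 first.
- by apply: bddmM => //; exact: bddm_cst.
- by apply: bddmD => //; apply: bddmM => //; exact: bddm_cst.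
rewrite (@ExXY k (fun x => x * ind x) id) // Y0 mulr0 mulr0 add0r.
by rewrite (@ExXY k ind (fun y => y ^+ 2)) // Y2.
Qed.

Let e_anti k m : (k <= m)%N -> e m <= e k.
Proof.
move=> /subnK <-; elim: (m - k)%N => [//|j IH].
by apply: le_trans IH; apply: le_Ex => // t; exact: indic_stopped_antitone.
Qed.

(** The second moment grows by [s2 * e k] at step [k], with [e k >= e N], while the stopped walk
    stays bounded by [A + B + M], where [M] covers the overshoot. *)
Let e_le N : N%:R * s2 * e N <= (A + B + M) ^+ 2.
Proof.
apply: (@le_trans _ _ (Ex P (fun t => X N t ^+ 2))); last first.
  rewrite -(Ex_cst P ((A + B + M) ^+ 2)); apply: le_Ex.
  - exact: (bddmM (bX N) (bX N)).
  - exact: bddm_cst.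
  - move=> t; have := @stopped_bounds (Y^~ t) N M A0 B0 (YM^~ t); rewrite -/(X N t) => /andP[h1 h2].
    have h3 : 0 <= (A + B + M - X N t) * (A + B + M + X N t).
      by apply: mulr_ge0; move: A0 B0 h1 h2; lra.
    move: h3; lra.
have : forall k, (k <= N)%N -> k%:R * s2 * e N <= Ex P (fun t => X k t ^+ 2).
  elim=> [_|k IH kN].
    rewrite mul0r mul0r; have -> : (fun t => X 0%N t ^+ 2) = fun=> 0.
      by apply/funext => t; rewrite /X /= expr0n.
    by rewrite Ex_cst.
  rewrite ExX2 -natr1; have := IH (ltnW kN).
  by have := ler_wpM2r (ltW s20) (e_anti (ltnW kN)); lra.
exact.
Qed.

(** If the walk is not below, it is still inside, an event of probability [e N], or it left at the
    top. The variable [X N + A + M] is nonnegative, has mean [A + M] and is at least [A + B + M] at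
    the top, so the Markov inequality handles the second case. *)
Lemma stopped_not_below N : (0 < N)%N ->
  fine (P [set t | - A < stopped (Y^~ t) N]) <=
  (A + M) / (A + B + M) + (A + B + M) ^+ 2 / (N%:R * s2).
Proof.
move: (A0) (B0) => hA0 hB0 N0; have M0 : 0 <= M by have := YM 0%N point; apply: le_trans.
have mE : measurable [set t | - A < X N t].
  have [mX _] := bX N; have := mX measurableT `]- A, +oo[%classic (measurable_itv _).
  rewrite setTI (_ : _ @^-1` _ = [set t | - A < X N t]) //.
  by apply/seteqP; split=> t /=; rewrite in_itv /= andbT.
rewrite -/(X N) -Ex_indic //.
have c0 : 0 < A + B + M by move: A0 B0; lra.
apply: (@le_trans _ _ (Ex P (fun t => (A + B + M)^-1 * (X N t + (A + M)) + ind (X N t)))).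
  apply: le_Ex; first exact: bddm_indic.
    apply: bddmD => //; apply: bddmM; first exact: bddm_cst.
    by apply: bddmD => //; exact: bddm_cst.
  move=> t; have /andP[h1 h2] := @stopped_bounds (Y^~ t) N M A0 B0 (YM^~ t).
  have h3 : 0 <= (A + B + M)^-1 * (X N t + (A + M)).
    by rewrite mulr_ge0 ?invr_ge0 ?(ltW c0) // /X; lra.
  have h6 : 0 <= ind (X N t) by rewrite /ind indicE.
  rewrite indicE; have [|] := boolP (t \in _); last by move=> _; exact: addr_ge0.
  rewrite inE /= => h4; have [h5|h5] := ltP (X N t) B.
    by rewrite /ind indicE mem_set /= ?lerDr // in_itv /= h4.
  rewrite ler_wpDr //.
  by rewrite mulrC ler_pdivlMr // mul1r; lra.
rewrite ExD //; last first.
  apply: bddmM; first exact: bddm_cst.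
  by apply: bddmD => //; exact: bddm_cst.
rewrite ExZ; last by apply: bddmD => //; exact: bddm_cst.
rewrite ExD //; last exact: bddm_cst.
rewrite ExX Ex_cst add0r mulrC lerD2l ler_pdivlMr ?mulr_gt0 ?ltr0n //.
by rewrite mulrC; exact: e_le.
Qed.

End StoppedWalk.

(** * The random potential *)

Section Potential.
Variable R : realType.
Implicit Types (w : int -> R) (x : int).

Lemma ln_rhoE (a : R) : 0 < a < 1 -> ln (rho a) = ln (1 - a) - ln a.
Proof. by move=> /andP[h1 h2]; rewrite /rho ln_div // posrE subr_gt0. Qed.

Lemma ln_rho_mirror (a : R) : 0 < a < 1 -> ln (rho (1 - a)) = - ln (rho a).
Proof.
move=> h; rewrite !ln_rhoE //; first by rewrite subKr; lra.
by case/andP: h => h1 h2; apply/andP; split; lra.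
Qed.

Lemma ln_rho_bound (a e : R) : 0 < e -> e <= a <= 1 - e -> `|ln (rho a)| <= - ln e.
Proof.
move=> e0 /andP[h1 h2]; have a01 : 0 < a < 1 by apply/andP; split; lra.
have aux b : e <= b -> b <= 1 -> ln e <= ln b <= 0.
  by move=> eb b1; rewrite ler_ln ?posrE ?eb ?ln_le0 //; lra.
have /andP[h3 h4] : ln e <= ln a <= 0 by apply: aux; lra.
have /andP[h5 h6] : ln e <= ln (1 - a) <= 0 by apply: aux; lra.
by rewrite ln_rhoE //; apply/ler_normlP; split; lra.
Qed.

Lemma expV_expR w x i : (forall y, 0 < w y < 1) ->
  expV w x i = expR (\sum_(k < i) ln (rho (w (x + k.+1%:Z)))).
Proof.
move=> w01; rewrite /expV expR_sum; apply: eq_bigr => k _.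
rewrite lnK // posrE /rho; have /andP[h1 h2] := w01 (x + k.+1%:Z).
by rewrite divr_gt0 // subr_gt0.
Qed.

Lemma expV_mirror w x i : (forall y, 0 < w y < 1) ->
  expV (mirror w) (- x) i = expR (\sum_(k < i) - ln (rho (w (x - k.+1%:Z)))).
Proof.
move=> w01; rewrite expV_expR; last exact: mirror01.
congr expR; apply: eq_bigr => k _.
by rewrite /mirror opprD opprK ln_rho_mirror.
Qed.

End Potential.

Section Environment.
Context d (T : measurableType d) (R : realType) (P : probability T R).
Variables (eta : int -> T -> R) (e s2 : R).
Hypotheses (e0 : 0 < e) (s20 : 0 < s2).
Hypothesis meta : forall x, measurable_fun setT (eta x).
Hypothesis etae : forall x t, e <= eta x t <= 1 - e.
Hypothesis eta_indep :
  independent P setT (fun x => preimage_set_system setT (eta x) measurable).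
Hypothesis eta_mean : forall x, Ex P (fun t => ln (rho (eta x t))) = 0.
Hypothesis eta_var : forall x, Ex P (fun t => ln (rho (eta x t)) ^+ 2) = s2.

Let eta01 x t : 0 < eta x t < 1.
Proof. by have /andP[h1 h2] := etae x t; move: e0 => he; apply/andP; split; lra. Qed.

Let sub_sigma (D : set int) :=
  <<s \bigcup_(x in D) preimage_set_system setT (eta x) measurable >>.

Let blocks (D1 D2 : set int) C C' : D1 `&` D2 = set0 -> sub_sigma D1 C ->
  sub_sigma D2 C' -> P (C `&` C') = (P C * P C')%E.
Proof.
move=> D12; apply: (independent_blocks _ _ _ eta_indep D12) => x.
- move=> _ _ [A mA <-] [B mB <-]; exists (A `&` B); first exact: measurableI.
  by rewrite !setTI preimage_setI.
- by exists setT; rewrite // setTI preimage_setT.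
- by move=> _ [A mA <-]; apply: meta.
Qed.

(** The sign [c] and the enumeration [f] of sites let one exit estimate serve descents and ascents
    of the potential, to the right and to the left. *)
Definition env_steps (c : R) (f : nat -> int) k t := c * ln (rho (eta (f k) t)).

Let preimage_steps c f (D : set int) k C : D (f k) -> measurable C ->
  sub_sigma D (env_steps c f k @^-1` C).
Proof.
move=> Dk mC; apply: sub_sigma_algebra; exists (f k) => //.
pose phi (a : R) := c * (ln (1 - a) - ln a).
have mphi : measurable_fun setT phi.
  apply: measurable_funM => //; apply: measurable_funB => //.
  by apply: (measurableT_comp (@measurable_ln R)); apply: measurable_funB.
exists (phi @^-1` C); first by rewrite -[X in measurable X]setTI; exact: mphi.
by rewrite setTI; apply/seteqP; split=> t /=; rewrite /env_steps /phi ln_rhoE.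
Qed.

Let sub_sigma_measurable D C : sub_sigma D C -> measurable C.
Proof.
apply: smallest_sub; first exact: sigma_algebra_measurable.
by move=> _ [y _ [C' mC' <-]]; apply: meta.
Qed.

Lemma stopped_sigma c f (D : set int) A B N : (forall k, D (f k)) ->
  sub_sigma D [set t | - A < stopped A B (fun k => env_steps c f k t) N].
Proof.
move=> Df; pose G := \bigcup_(x in D) preimage_set_system setT (eta x) measurable.
pose T' : measurableType G.-sigma := g_sigma_algebraType G.
have mX : measurable_fun setT
    ((fun t => stopped A B (fun k => env_steps c f k t) N) : T' -> R).
  apply: (@measurable_stopped _ _ _ _ T' (env_steps c f)) => i ik _ C mC.
  by rewrite setTI; exact: preimage_steps.
have := mX measurableT `]- A, +oo[%classic (measurable_itv _).
rewrite setTI (_ : _ @^-1` _ = [set t | - A < stopped A B (fun k => env_steps c f k t) N]) //.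
by apply/seteqP; split=> t /=; rewrite in_itv /= andbT.
Qed.

(** The exit time contributes the second term, through the growth of the second
moment; [- ln e] bounds the steps. *)
Definition exit_bound (A B : R) N : R :=
  (A - ln e) / (A + B - ln e) + (A + B - ln e) ^+ 2 / (N%:R * s2).

Lemma stopped_env_le c f A B N : `|c| = 1 -> injective f -> 0 < A -> 0 < B -> (0 < N)%N ->
  fine (P [set t | - A < stopped A B (fun k => env_steps c f k t) N]) <= exit_bound A B N.
Proof.
move=> c1 finj A0 B0 N0.
have mlr x : measurable_fun setT (fun t => ln (rho (eta x t))).
  rewrite (_ : (fun t => _) = fun t => ln (1 - eta x t) - ln (eta x t)).
    apply: measurable_funB; apply: (measurableT_comp (@measurable_ln R)) => //.
    exact: measurable_funB.
  by apply/funext => t; rewrite ln_rhoE.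
have blr x : bddm (fun t => ln (rho (eta x t))).
  by split=> //; exists (- ln e) => t; exact: ln_rho_bound.
(* The past of step [k] is generated by the sites [f i] with [i < k]; injectivity of [f] keeps the
   site [f k] out of it. *)
apply: (@stopped_not_below _ _ _ _ _ P (env_steps c f)
  (fun k => \bigcup_(x in [set f i | i in `I_k]) preimage_set_system setT (eta x) measurable)) => //.
- by move=> k; apply: measurable_funM.
- by move=> k t; rewrite normrM c1 mul1r; exact: ln_rho_bound.
- by move=> k; rewrite ExZ // eta_mean mulr0.
- move=> k; rewrite -(eta_var (f k)); congr Ex; apply/funext => t.
  by rewrite exprMn -(real_normK (num_real c)) c1 expr1n mul1r.
- by move=> k i C ik mC; apply: preimage_steps => //; exists i.
- move=> k C D hC mD; apply: (@blocks [set f i | i in `I_k] [set f k]) => //.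
    by apply/seteqP; split=> // x [[i ik <-]] /finj e'; move: ik; rewrite e' /= ltnn.
  exact: preimage_steps.
Qed.

Lemma valley_fail_le x A B N : 0 < A -> 0 < B -> (0 < N)%N -> exists2 E : set T,
  measurable E /\ fine (P E) <= exit_bound A B N ^+ 2 &
  forall t, ~ E t -> valley (eta^~ t) x N (expR (- A)) (expR B) \/
                     valley (mirror (eta^~ t)) (- x) N (expR (- A)) (expR B).
Proof.
move=> A0 B0 N0.
pose f (k : nat) : int := x + k.+1%:Z; pose g (k : nat) : int := x - k.+1%:Z.
pose ER := [set t | - A < stopped A B (fun k => env_steps 1 f k t) N].
pose EL := [set t | - A < stopped A B (fun k => env_steps (-1) g k t) N].
have fi : injective f by move=> i j; rewrite /f; lia.
have gi : injective g by move=> i j; rewrite /g; lia.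
have hR : sub_sigma (range f) ER by apply: stopped_sigma => k; exists k.
have hL : sub_sigma (range g) EL by apply: stopped_sigma => k; exists k.
have mR := sub_sigma_measurable hR; have mL := sub_sigma_measurable hL.
exists (ER `&` EL); first split; first exact: measurableI.
  (* Both increments start at a neighbour of [x], so the environment at [x] itself enters neither
     side and the two sides are independent. *)
  rewrite (blocks _ hR hL); last first.
    by apply/seteqP; split=> // y [[i _ <-] [j _]]; rewrite /f /g; lia.
  rewrite fineM ?fin_num_measure // expr2; apply: ler_pM; try exact: fine_ge0.
  - by apply: stopped_env_le => //; rewrite normr1.
  - by apply: stopped_env_le => //; rewrite normrN1.
move=> t hE; have [hER|hER] := pselect (ER t).
  right; have /negP : ~ EL t by move=> ?; apply: hE.
  rewrite -leNgt => /stopped_exit => /(_ A0 B0)[Y YN [h1 h2]].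
  exists Y; split=> //.
    by rewrite expV_mirror ?ler_expR //; under eq_bigr do rewrite -mulN1r.
  move=> i iY; rewrite expV_mirror ?ler_expR //; under eq_bigr do rewrite -mulN1r.
  by apply: ltW; exact: h2.
left; move/negP : hER.
rewrite -leNgt => /stopped_exit => /(_ A0 B0)[Y YN [h1 h2]].
exists Y; split=> //.
  by rewrite expV_expR ?ler_expR //; under eq_bigr do rewrite -[ln _]mul1r.
move=> i iY; rewrite expV_expR ?ler_expR //; under eq_bigr do rewrite -[ln _]mul1r.
by apply: ltW; exact: h2.
Qed.

(** Here the potential has to rise on both sides, so failures add up instead of multiplying;
    smallness will come from taking [B] much larger than [A]. *)
Lemma barrier_fail_le A B N : 0 < A -> 0 < B -> (0 < N)%N -> exists2 E : set T,
  measurable E /\ fine (P E) <= 2 * exit_bound A B N &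
  forall t, ~ E t -> (exists2 Y, (Y <= N)%N & expR A <= expV (eta^~ t) 0 Y) /\
                     (exists2 Y, (Y <= N)%N & expR A <= expV (mirror (eta^~ t)) 0 Y).
Proof.
move=> A0 B0 N0.
pose f (k : nat) : int := 0 + k.+1%:Z; pose g (k : nat) : int := 0 - k.+1%:Z.
pose ER := [set t | - A < stopped A B (fun k => env_steps (-1) f k t) N].
pose EL := [set t | - A < stopped A B (fun k => env_steps 1 g k t) N].
have fi : injective f by move=> i j; rewrite /f; lia.
have gi : injective g by move=> i j; rewrite /g; lia.
have hR : sub_sigma (range f) ER by apply: stopped_sigma => k; exists k.
have hL : sub_sigma (range g) EL by apply: stopped_sigma => k; exists k.
have mR := sub_sigma_measurable hR; have mL := sub_sigma_measurable hL.
exists (ER `|` EL); first split; first exact: measurableU.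
  apply: (@le_trans _ _ (fine (P ER) + fine (P EL))).
    rewrite -fineD ?fin_num_measure // fine_le ?fin_numD ?fin_num_measure //.
      exact: measurableU.
    exact: measureU2.
  rewrite mulr_natl mulr2n; apply: lerD; apply: stopped_env_le => //.
  - by rewrite normrN1.
  - by rewrite normr1.
move=> t hE; split.
  have /negP : ~ ER t by move=> ?; apply: hE; left.
  rewrite -leNgt => /stopped_exit => /(_ A0 B0)[Y YN [h1 h2]].
  exists Y => //; rewrite expV_expR ?ler_expR // -[leRHS]opprK -sumrN lerNr.
  by under eq_bigr do rewrite -mulN1r.
have /negP : ~ EL t by move=> ?; apply: hE; right.
rewrite -leNgt => /stopped_exit => /(_ A0 B0)[Y YN [h1 h2]].
exists Y => //; rewrite -oppr0 expV_mirror ?ler_expR // sumrN lerNr.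
by under eq_bigr do rewrite -[ln _]mul1r.
Qed.

End Environment.

(** * Tail of the quenched probability of being at a given site *)

Section SingleWalk.
Context d (T : measurableType d) (R : realType).

Lemma measurable_walk_prob (eta : int -> T -> R) n x y :
  (forall z, measurable_fun setT (eta z)) ->
  measurable_fun setT (fun t => walk_prob (eta^~ t) n x y).
Proof.
move=> meta; elim: n y => [|n IH] y; first exact: measurable_cst.
rewrite (_ : (fun t => _) = fun t => eta y t * walk_prob (eta^~ t) n x (y + 1) +
  (1 - eta y t) * walk_prob (eta^~ t) n x (y - 1)) //.
apply: measurable_funD; apply: measurable_funM => //.
exact: measurable_funB.
Qed.

Lemma nat_above (a : R) : 0 <= a -> exists N, a <= N%:R <= a + 1.
Proof.
move=> a0; exists (Num.truncn a).+1; have /andP[h1 h2] := truncn_itv a0.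
by rewrite ltW //= -natr1 lerD2r.
Qed.

Variable P : probability T R.
Variables (eta : int -> T -> R) (e s2 : R).
Hypotheses (e0 : 0 < e) (s20 : 0 < s2).
Hypothesis meta : forall x, measurable_fun setT (eta x).
Hypothesis etae : forall x t, e <= eta x t <= 1 - e.
Hypothesis eta_indep :
  independent P setT (fun x => preimage_set_system setT (eta x) measurable).
Hypothesis eta_mean : forall x, Ex P (fun t => ln (rho (eta x t))) = 0.
Hypothesis eta_var : forall x, Ex P (fun t => ln (rho (eta x t)) ^+ 2) = s2.

(* [l] is [log n] and [m] is [log log n]. *)
Section LogLog.
Variables (n : nat) (l m : R).
Hypotheses (n0 : (0 < n)%N) (nl : n%:R = expR l) (lm : l = expR m).
Hypotheses (m88 : 88 <= m) (me : - ln e <= m).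

Let M0 : 0 <= - ln e.
Proof.
have /andP[h1 h2] := etae 0 point; move: e0 => he.
by rewrite oppr_ge0 ln_le0 //; lra.
Qed.

(** Here [l = expR m] dominates [m ^+ 2 / 2], and [88 = 2 * 44]. The bound keeps [l - 22 * m] above
    [l / 2]. *)
Let ml : 44 * m <= l.
Proof.
have m0 : 0 <= m by move: m88; lra.
have := @expR_ge1Dxn R m 1 m0; rewrite -lm (_ : 2`!%:R = 2 :> R) // => h.
have := ler_wpM2r m0 m88; rewrite -expr2.
move: (m ^+ 2) h => q; lra.
Qed.

Let l0 : 0 < l. Proof. by rewrite lm expR_gt0. Qed.

Let l1 : 1 <= l. Proof. by move: ml m88; lra. Qed.

(** The constant 38 is [19 * m], which bounds [18 * m - ln e], over a width at least [l / 2]. The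
    width is also at most [l], so [l ^+ 4] sites make the exit-time term of order [1 / l ^+ 2]. *)
Lemma valley_exit_bound N : l ^+ 4 <= N%:R ->
  exit_bound e s2 (18 * m) (l - 22 * m) N <= (38 + s2^-1) * m / l.
Proof.
move=> hN; rewrite /exit_bound; set M := - ln e.
have l40 : 0 < l ^+ 4 by exact: exprn_gt0.
have h1 : (18 * m + M) / (18 * m + (l - 22 * m) + M) <= 38 * m / l.
  rewrite ler_pdivrMr; last by move: ml m88 M0; rewrite -/M; lra.
  have : 38 * m * (l / 2) / l = 19 * m by field; rewrite lt0r_neq0.
  have : l / 2 <= 18 * m + (l - 22 * m) + M by move: ml m88 M0; rewrite -/M; lra.
  move=> /(@ler_wpM2l _ (38 * m / l)) h h'.
  have {}h := h ltac:(by rewrite divr_ge0 ?(ltW l0) //; move: m88; lra).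
  apply: le_trans h; rewrite mulrAC h'; move: me; rewrite -/M; lra.
have h2 : (18 * m + (l - 22 * m) + M) ^+ 2 / (N%:R * s2) <= s2^-1 * m / l.
  apply: (@le_trans _ _ (l ^+ 2 / (l ^+ 4 * s2))).
    apply: ler_pM; rewrite ?sqr_ge0 ?invr_ge0 ?mulr_ge0 ?(ltW s20) //.
      rewrite ler_sqr ?nnegrE; move: ml m88 M0 me l0; rewrite -/M; lra.
    rewrite lef_pV2 ?posrE ?mulr_gt0 // ?(lt_le_trans l40 hN) //.
    by rewrite ler_wpM2r // ltW.
  have -> : l ^+ 2 / (l ^+ 4 * s2) = s2^-1 * l^-1 / l by field; rewrite !lt0r_neq0.
  apply: ler_wpM2r; first by rewrite invr_ge0 ltW.
  apply: ler_wpM2l; first by rewrite invr_ge0 ltW.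
  by apply: (@le_trans _ _ 1); [rewrite invf_le1|move: m88; lra].
by apply: le_trans (lerD h1 h2) _; rewrite -!mulrDl.
Qed.

(** A climb of order [l] against a drop of [l ^+ 3] fails with probability of order [1 / l ^+ 2];
    the exit-time term [(l ^+ 3) ^+ 2 / N] has the same order for [N = l ^+ 8], which fixes the
    range of sites. *)
Lemma barrier_exit_bound N : l ^+ 8 <= N%:R ->
  exit_bound e s2 (l + 2 * m) (l ^+ 3) N <= (2 + 9 / s2) / l ^+ 2.
Proof.
move=> hN; rewrite /exit_bound; set M := - ln e.
have l30 : 0 < l ^+ 3 by exact: exprn_gt0.
have l20 : 0 < l ^+ 2 by exact: exprn_gt0.
have l80 : 0 < l ^+ 8 by exact: exprn_gt0.
have hl3 : l <= l ^+ 3.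
  by rewrite -[leLHS]expr1 ler_weXn2l.
have h1 : (l + 2 * m + M) / (l + 2 * m + l ^+ 3 + M) <= 2 / l ^+ 2.
  rewrite ler_pdivrMr; last by move: ml m88 M0; rewrite -/M; lra.
  have e1 : 2 / l ^+ 2 * l ^+ 3 = 2 * l by field; rewrite lt0r_neq0.
  have : l ^+ 3 <= l + 2 * m + l ^+ 3 + M by move: ml m88 M0; rewrite -/M; lra.
  move=> /(@ler_wpM2l _ (2 / l ^+ 2)) h.
  have {}h := h ltac:(by rewrite divr_ge0 // ltW).
  by apply: le_trans h; rewrite e1; move: ml me m88; rewrite -/M; lra.
have h2 : (l + 2 * m + l ^+ 3 + M) ^+ 2 / (N%:R * s2) <= (9 / s2) / l ^+ 2.
  apply: (@le_trans _ _ ((3 * l ^+ 3) ^+ 2 / (l ^+ 8 * s2))).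
    apply: ler_pM; rewrite ?sqr_ge0 ?invr_ge0 ?mulr_ge0 ?(ltW s20) //.
      rewrite ler_sqr ?nnegrE; move: ml m88 M0 me l0; rewrite -/M; lra.
    rewrite lef_pV2 ?posrE ?mulr_gt0 // ?(lt_le_trans l80 hN) //.
    by rewrite ler_wpM2r // ltW.
  rewrite le_eqVlt; apply/orP; left; apply/eqP; field.
  by rewrite !lt0r_neq0.
by apply: le_trans (lerD h1 h2) _; rewrite -mulrDl.
Qed.

(* Near the origin the losses are a factor [l ^+ 16] from the squared distance and
   [l ^+ 4] from the width of the valley, whence the depths [18 * m] and
   [l - 22 * m]. *)
Lemma walk_prob_fail_le x : exists2 E : set T,
  measurable E /\ fine (P E) <= ((38 + s2^-1) ^+ 2 + 2 * (2 + 9 / s2)) * m ^+ 2 / l ^+ 2 &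
  forall t, ~ E t -> walk_prob (eta^~ t) n x 0 <= 32 / e / l ^+ 2.
Proof.
have l20 : 0 < l ^+ 2 by exact: exprn_gt0.
have nr0 : 0 < n%:R :> R by rewrite ltr0n.
have n1 : n.+1%:R <= 2 * n%:R :> R.
  by rewrite -natrM ler_nat mul2n -addnn -addn1 leq_add2l.
have m1 : 1 <= m ^+ 2 by apply: exprn_ege1; move: m88; lra.
have s2i : 0 <= s2^-1 by rewrite invr_ge0 ltW.
have [N2 /andP[hN2 hN2']] := nat_above (exprn_ge0 8 (ltW l0)).
have l81 : 1 <= l ^+ 8 by exact: exprn_ege1.
have N2pos : (0 < N2)%N by rewrite -(ltr0n R); apply: lt_le_trans hN2; exact: exprn_gt0.
have [hx|hx] := ltnP `|x| N2.
  have [N1 /andP[hN1 hN1']] := nat_above (exprn_ge0 4 (ltW l0)).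
  have l41 : 1 <= l ^+ 4 by exact: exprn_ege1.
  have N1pos : (0 < N1)%N by rewrite -(ltr0n R); apply: lt_le_trans hN1; exact: exprn_gt0.
  have A0 : 0 < 18 * m by move: m88; lra.
  have B0 : 0 < l - 22 * m by move: ml m88; lra.
  have [E [mE hE] hv] := valley_fail_le e0 s20 meta etae eta_indep eta_mean eta_var x A0 B0 N1pos.
  exists E; first split=> //.
    apply: le_trans hE _.
    have hb := valley_exit_bound hN1.
    have hb0 : 0 <= exit_bound e s2 (18 * m) (l - 22 * m) N1.
      rewrite /exit_bound addr_ge0 // divr_ge0 ?sqr_ge0 //.
      - by move: M0 A0; lra.
      - by move: M0 A0 B0; lra.
      - by rewrite mulr_ge0 // ltW.
    apply: (@le_trans _ _ (((38 + s2^-1) * m / l) ^+ 2)).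
      by rewrite ler_sqr ?nnegrE // (le_trans hb0).
    rewrite !exprMn exprVn ler_wpM2r ?invr_ge0 ?(ltW l20) //.
    rewrite ler_wpM2r ?sqr_ge0 // lerDl; lra.
  move=> t /hv hval.
  have := walk_prob_valley_le n e0 (etae^~ t) (expR_ge0 _) hval.
  set p := walk_prob _ _ _ _ => hp.
  have e1 : expR (l - 22 * m) = n%:R / l ^+ 22.
    by rewrite expRB -nl expRM_natl -lm.
  have e2 : expR (- (18 * m)) = (l ^+ 18)^-1.
    by rewrite expRN expRM_natl -lm.
  rewrite e1 e2 in hp.
  have hx2 : (`|x|%N).+1%:R ^+ 2 <= (2 * l ^+ 8) ^+ 2 :> R.
    rewrite ler_sqr ?nnegrE // ?mulr_ge0 ?exprn_ge0 ?(ltW l0) //.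
    apply: (@le_trans _ _ (N2%:R)); first by rewrite ler_nat.
    by move: hN2' l81; lra.
  have h3 : N1%:R * (n%:R / l ^+ 22) + n.+1%:R / l ^+ 18 <= 4 * n%:R / l ^+ 18.
    apply: (@le_trans _ _ (2 * l ^+ 4 * (n%:R / l ^+ 22) + 2 * n%:R / l ^+ 18)).
      apply: lerD; apply: ler_wpM2r => //.
      - by rewrite divr_ge0 // exprn_ge0 // ltW.
      - by move: hN1' l41; lra.
      - by rewrite invr_ge0 exprn_ge0 // ltW.
    rewrite le_eqVlt; apply/orP; left; apply/eqP; field; rewrite lt0r_neq0 //.
  (* The origin of 32: [2 * (2 * l ^+ 8) ^+ 2 * 4 / l ^+ 18 = 32 / l ^+ 2]. *)
  have h4 : e * n%:R * p <= 2 * (2 * l ^+ 8) ^+ 2 * (4 * n%:R / l ^+ 18).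
    apply: le_trans hp _; apply: ler_pM => //.
    - by apply: addr_ge0; rewrite ?mulr_ge0 ?divr_ge0 ?invr_ge0 ?exprn_ge0 ?(ltW l0).
    - by apply: ler_wpM2l.
  rewrite -(ler_pM2l (mulr_gt0 e0 nr0)); apply: le_trans h4 _.
  rewrite le_eqVlt; apply/orP; left; apply/eqP; field.
  by rewrite !lt0r_neq0.
(* Far sites: a barrier of height [l + 2 * m] has weight [n * l ^+ 2], against at most
   [n.+1 <= 2 * n] visits. *)
have A0 : 0 < l + 2 * m by move: m88 l0; lra.
have B0 : 0 < l ^+ 3 by exact: exprn_gt0.
have [E [mE hE] hv] := barrier_fail_le e0 s20 meta etae eta_indep eta_mean eta_var A0 B0 N2pos.
exists E; first split=> //.
  apply: le_trans hE _; apply: (@le_trans _ _ (2 * ((2 + 9 / s2) / l ^+ 2))).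
    by apply: ler_wpM2l => //; exact: barrier_exit_bound.
  rewrite mulrA; apply: ler_wpM2r; first by rewrite invr_ge0 ltW.
  rewrite -[leLHS]mulr1; apply: ler_pM => //; first lra.
  have := sqr_ge0 (38 + s2^-1); lra.
move=> t /hv [[Y YN hY] [Y' YN' hY']].
have key Z : (Z <= N2)%N -> ((0 <= x)%R -> expR (l + 2 * m) <= expV (eta^~ t) 0 Z) ->
    ((x <= 0)%R -> expR (l + 2 * m) <= expV (mirror (eta^~ t)) 0 Z) ->
    walk_prob (eta^~ t) n x 0 <= 32 / e / l ^+ 2.
  move=> ZN h1 h2.
  have := walk_prob_far_le n e0 (etae^~ t) (expR_ge0 _) (leq_trans ZN hx) h1 h2.
  set p := walk_prob _ _ _ _.
  have -> : expR (l + 2 * m) = n%:R * l ^+ 2.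
    by rewrite expRD -nl expRM_natl -lm.
  move=> h3; have c0 : 0 < e * (n%:R * l ^+ 2) by rewrite !mulr_gt0.
  rewrite -(ler_pM2l c0); apply: le_trans h3 _.
  have -> : e * (n%:R * l ^+ 2) * (32 / e / l ^+ 2) = 32 * n%:R.
    by field; rewrite !lt0r_neq0.
  by move: n1 nr0; lra.
have [hx0|hx0] := leP 0%R x.
  apply: (key Y YN (fun _ => hY)) => h; exfalso.
  have x0 : x = 0 by apply/le_anti; rewrite h hx0.
  by move: hx N2pos; rewrite x0 absz0 leqn0 => /eqP ->.
apply: (key Y' YN' _ (fun _ => hY')) => h; exfalso.
by move: hx0; rewrite ltNge h.
Qed.

End LogLog.

Lemma walk_prob_tail eps : 0 < eps -> exists C n0, 0 < C /\ forall n, (n0 <= n)%N ->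
  1 < ln n%:R :> R /\ forall x,
  fine (P [set t | C / ln n%:R ^+ 2 < walk_prob (eta^~ t) n x 0]) <=
    C / ln n%:R ^+ 2 * ln n%:R `^ eps.
Proof.
move=> eps0.
pose D := (38 + s2^-1) ^+ 2 + 2 * (2 + 9 / s2).
have s2i : 0 < s2^-1 by rewrite invr_gt0.
have D0 : 0 < D by have := sqr_ge0 (38 + s2^-1); rewrite /D; lra.
pose C := 32 / e + D * (2 / eps) ^+ 2.
have hC1 : 0 < 32 / e by rewrite divr_gt0.
have hC2 : 0 < D * (2 / eps) ^+ 2 by rewrite mulr_gt0 // exprn_gt0 // divr_gt0.
(* A lower bound for [log log n] that gives both [m88] and [me]. *)
pose K := 88 + `|ln e|.
have [n0 /andP[hn0 _]] := nat_above (expR_ge0 (expR K)).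
exists C, n0; split=> [|n hn]; first by rewrite addr_gt0.
set l := ln n%:R; have hnK : expR (expR K) <= n%:R.
  by apply: le_trans hn0 _; rewrite ler_nat.
have npos : 0 < n%:R :> R by apply: lt_le_trans hnK; exact: expR_gt0.
have nl : n%:R = expR l by rewrite lnK // posrE.
have hlK : expR K <= l by rewrite -ler_expR -nl.
have lpos : 0 < l by apply: lt_le_trans hlK; exact: expR_gt0.
pose m := ln l; have lm : l = expR m by rewrite lnK // posrE.
have hmK : K <= m by rewrite -ler_expR -lm.
have m88 : 88 <= m by apply: le_trans hmK; rewrite /K lerDl.
have me : - ln e <= m.
  by apply: le_trans hmK; have := ler_norm (- ln e); rewrite normrN /K; lra.
have l1 : 1 < l by rewrite lm expR_gt1; lra.
split=> // x.
have np : (0 < n)%N by rewrite -(ltr0n R).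
have [E [mE hE] hp] := walk_prob_fail_le np nl lm m88 me x.
have l20 : 0 < l ^+ 2 by exact: exprn_gt0.
apply: (@le_trans _ _ (fine (P E))).
  have mS : measurable [set t | C / l ^+ 2 < walk_prob (eta^~ t) n x 0].
    have := measurable_walk_prob n x 0 meta measurableT (measurable_itv `]C / l ^+ 2, +oo[).
    rewrite setTI (_ : _ @^-1` _ = [set t | C / l ^+ 2 < walk_prob (eta^~ t) n x 0]) //.
    by apply/seteqP; split=> t /=; rewrite in_itv /= andbT.
  rewrite fine_le ?fin_num_measure //; apply: le_measure; rewrite ?inE //.
  move=> t /= hlt; apply: contrapT => /hp; apply/negP; rewrite -ltNge.
  apply: le_lt_trans hlt; rewrite ler_wpM2r ?invr_ge0 ?(ltW l20) // /C.
  by rewrite lerDl ltW.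
apply: le_trans hE _; rewrite -/D.
(* The logarithm [m] of [l] is compared with the power [eps / 2] of [l], since [m] enters
   squared. *)
have hm : m ^+ 2 <= (2 / eps) ^+ 2 * l `^ eps.
  have h1 : m <= 2 / eps * l `^ (eps / 2).
    have := ln_sublinear (powR_gt0 (eps / 2) lpos); rewrite ln_powR -/m => /ltW h.
    have h2 : 0 <= 2 / eps by rewrite divr_ge0 // ltW.
    have := ler_wpM2l h2 h; rewrite mulrA (_ : 2 / eps * (eps / 2) = 1) ?mul1r //.
    by field; rewrite lt0r_neq0.
  have e1 : l `^ eps = (l `^ (eps / 2)) ^+ 2.
    by rewrite -powR_mulrn ?powR_ge0 // -powRrM; congr powR; field.
  rewrite e1 -exprMn ler_sqr ?nnegrE //; last by rewrite mulr_ge0 ?powR_ge0 ?divr_ge0 // ltW.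
  lra.
rewrite [leRHS]mulrAC; apply: ler_wpM2r; first by rewrite invr_ge0 ltW.
apply: le_trans (ler_wpM2l (ltW D0) hm) _; rewrite mulrA; apply: ler_wpM2r.
  exact: powR_ge0.
by rewrite /C lerDr ltW.
Qed.

End SingleWalk.

(** * From the quenched law to collisions *)

(** [walk_prob] is defined by its first step, whereas the Markov property adds a last step: the
    forward equation joins the two. *)
Lemma walk_prob_forward (R : realFieldType) (w : int -> R) n x y :
  walk_prob w n.+1 x y =
  w (x - 1) * walk_prob w n (x - 1) y + (1 - w (x + 1)) * walk_prob w n (x + 1) y.
Proof.
elim: n y => [|n IH] y; last first.
  rewrite walk_probS !IH !(walk_probS _ n _ y); ring.
rewrite walk_probS /walk_prob /hits /=.
have -> : (y + 1 == x) = (y == x - 1) by apply/eqP/eqP; lia.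
have -> : (y - 1 == x) = (y == x + 1) by apply/eqP/eqP; lia.
by case: eqP => [<-|_]; case: eqP => [<-|_]; rewrite ?mulr0.
Qed.

(** * One-time laws of a Markov chain on the integers *)

Section CountablePartition.
Context d (W : measurableType d) (R : realType) (Q : {measure set W -> \bar R}).
Local Open Scope ereal_scope.

Lemma preimage_int (X : {mfun W >-> int}) (B : set int) : measurable (X @^-1` B).
Proof. by rewrite -[X in measurable X]setTI; apply: (@measurable_funPT _ _ _ _ X). Qed.

(** The integers are enumerated by [choice.pickle]; an index that codes no integer contributes the
    empty set. *)
Lemma measure_int_partition (X : {mfun W >-> int}) (A : set W) : measurable A ->
  Q A = \sum_(0 <= i <oo) Q (A `&` X @^-1` [set x | choice.pickle x = i]).
Proof.
move=> mA; pose F i := A `&` X @^-1` [set x | choice.pickle x = i].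
have eA : A = \bigcup_i F i.
  apply/seteqP; split=> t; last by move=> [i _ []].
  by move=> At; exists (choice.pickle (X t)).
have mF i : measurable (F i) by apply: measurableI => //; exact: preimage_int.
rewrite [in LHS]eA; apply: measure_semi_bigcup => //; last by rewrite -eA.
apply/trivIsetP => i j _ _ /eqP ij; apply/seteqP; split=> // t [[_ e1] [_ e2]].
by apply: ij; exact: etrans (esym e1) e2.
Qed.

Section Chain.
Variables (p : int -> int -> R) (x0 : int) (Z : nat -> {mfun W >-> int}).
Hypothesis Qfin : forall A, measurable A -> Q A \is a fin_num.
Hypothesis chain : markov_chain Q p x0 Z.

Let path m n (y : nat -> int) := [set t | forall k, (m <= k <= n)%N -> Z k t = y k].

Let mpath m n y : measurable (path m n y).
Proof.
rewrite (_ : path m n y = \bigcap_(k in [set k | (m <= k <= n)%N]) (Z k @^-1` [set y k])).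
  by apply: bigcap_measurableType => k _; exact: preimage_int.
by apply/seteqP; split.
Qed.

Let meq n z : measurable [set t | Z n t = z].
Proof. exact: (preimage_int (Z n) [set z]). Qed.

(** [markov_chain] conditions on the whole past. Summing over the position at one more early time in
    each induction step forgets the past progressively, until for [m = n] only the present is
    left. *)
Lemma markov_path m n y z : (m <= n)%N ->
  Q ([set t | Z n.+1 t = z] `&` path m n y) = (p (y n) z)%:E * Q (path m n y).
Proof.
elim: m y => [|m IH] y mn.
  have e : path 0 n y = [set t | forall k, (k <= n)%N -> Z k t = y k] by [].
  have [_ /(_ n y z)] := chain; rewrite /= -e.
  have [Q0 _|Q0 /(_ isT)] := eqVneq (Q (path 0 n y)) 0.
    rewrite Q0 mule0; apply/eqP; rewrite eq_le measure_ge0 andbT -Q0.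
    by apply: le_measure; rewrite ?inE; [exact: measurableI| |exact: subIsetr].
  rewrite /cond_prob => <-; rewrite -[in RHS](@fineK _ (Q (path 0 n y))) ?Qfin //.
  rewrite -EFinM divfK ?fineK ?Qfin //; first exact: measurableI.
  by apply: contra_neq Q0 => h; rewrite -(@fineK _ (Q (path 0 n y))) ?Qfin ?h.
have mA : measurable ([set t | Z n.+1 t = z] `&` path m.+1 n y) by exact: measurableI.
rewrite (measure_int_partition (Z m) mA) (measure_int_partition (Z m) (mpath m.+1 n y)).
rewrite -nneseriesZl //; apply: eq_eseriesr => i _.
have [[v hv]|hv] := pselect (exists v : int, choice.pickle v = i); last first.
  have -> : Z m @^-1` [set x | choice.pickle x = i] = set0.
    by apply/seteqP; split=> // t /= h; apply: hv; exists (Z m t).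
  by rewrite !setI0 measure0 mule0.
pose y' k := if k == m then v else y k.
have e : path m.+1 n y `&` Z m @^-1` [set x | choice.pickle x = i] = path m n y'.
  apply/seteqP; split=> t /=.
    move=> [h1 h2] k /andP[mk kn]; rewrite /y'; case: eqP => [->|/eqP km].
      by apply: (pcan_inj choice.pickleK); rewrite hv.
    by apply: h1; rewrite kn andbT ltn_neqAle eq_sym km.
  move=> h; split=> [k /andP[mk kn]|].
    by rewrite h ?(ltnW mk) // /y' gtn_eqF.
  have -> : Z m t = v; last exact: hv.
  by rewrite h ?leqnn ?(ltnW mn) // /y' eqxx.
rewrite -setIA e IH; last exact: ltnW.
by rewrite {1}/y' gtn_eqF.
Qed.

Lemma markov_step n y z :
  Q ([set t | Z n.+1 t = z] `&` [set t | Z n t = y]) = (p y z)%:E * Q [set t | Z n t = y].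
Proof.
have e : [set t | Z n t = y] = path n n (fun=> y).
  apply/seteqP; split=> t /= h; last by apply: h; rewrite leqnn.
  by move=> k hk; have -> : k = n by lia.
by rewrite e markov_path.
Qed.

End Chain.

Lemma walk_law (w : int -> R) (Z : nat -> {mfun W >-> int}) n x :
  (Q setT = 1) -> markov_chain Q (walk_transition w) 0%R Z ->
  Q [set t | Z n t = x] = (walk_prob w n x 0%R)%:E.
Proof.
move=> Q1 chain.
have Qfin A : measurable A -> Q A \is a fin_num.
  move=> mA; rewrite ge0_fin_numE //; apply: (@le_lt_trans _ _ (Q setT)).
    by apply: le_measure; rewrite ?inE.
  by rewrite Q1 ltry.
have meq m z : measurable [set t | Z m t = z] by exact: (preimage_int (Z m) [set z]).
elim: n x => [|n IH] x.
  have Z0 : Q [set t | Z 0%N t = 0%R] = 1 by have [] := chain.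
  rewrite /walk_prob /hits /=.
  have [<-//|/eqP hx] := eqVneq 0%R x.
  apply/eqP; rewrite eq_le measure_ge0 andbT.
  pose U := [set t | Z 0%N t = 0%R]; pose V := [set t | Z 0%N t = x].
  have eUV : Q (U `|` V) = Q U + Q V.
    apply: measureU; [exact: meq|exact: meq|].
    by apply/seteqP; split=> // t [e1 e2]; apply: hx; exact: etrans (esym e1) e2.
  have : Q (U `|` V) <= Q setT.
    by apply: le_measure; rewrite ?inE //; apply: measurableU; exact: meq.
  by rewrite eUV Z0 Q1 -[leRHS]adde0 leeD2lE.
set A := [set t | Z n.+1 t = x].
pose B1 := [set t | Z n t = (x - 1)%R]; pose B2 := [set t | Z n t = (x + 1)%R].
have mA : measurable A by exact: meq.
have mB1 : measurable B1 by exact: meq.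
have mB2 : measurable B2 by exact: meq.
pose B3 := Z n @^-1` [set y | y <> (x - 1)%R /\ y <> (x + 1)%R].
have mB3 : measurable B3 by exact: preimage_int.
(* Only the two neighbours lead to [x]. The other positions are excluded one at a time, as the
   Markov property speaks of single states. *)
have B30 : Q (A `&` B3) = 0.
  rewrite (measure_int_partition (Z n)); last exact: measurableI.
  apply: eseries0 => i _ _.
  have [[v [hv [hv1 hv2]]]|hv] :=
      pselect (exists v : int, choice.pickle v = i /\ v <> (x - 1)%R /\ v <> (x + 1)%R).
    apply/eqP; rewrite eq_le measure_ge0 andbT.
    apply: (@le_trans _ _ (Q (A `&` [set t | Z n t = v]))).
      apply: le_measure; rewrite ?inE //.
        by apply: measurableI; [exact: measurableI|exact: preimage_int].
        exact: measurableI.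
      by move=> t [[At _] /= h]; split=> //=; apply: (pcan_inj choice.pickleK); rewrite hv.
    rewrite (markov_step Qfin chain) /walk_transition.
    rewrite (_ : (x == v + 1)%R = false); last by apply/eqP; lia.
    by rewrite (_ : (x == v - 1)%R = false) ?mul0e //; apply/eqP; lia.
  rewrite (_ : _ `&` _ = set0) ?measure0 //; apply/seteqP; split=> // t [[_ hB] /= h].
  by apply: hv; exists (Z n t).
have eA : A = (A `&` B1) `|` ((A `&` B2) `|` (A `&` B3)).
  rewrite -!setIUr; apply/esym/setIidl => t _.
  have [h1|h1] := pselect (Z n t = (x - 1)%R); first by left.
  by right; have [h2|h2] := pselect (Z n t = (x + 1)%R); [left|right].
have e1 : Q ((A `&` B1) `|` ((A `&` B2) `|` (A `&` B3))) =
    Q (A `&` B1) + Q ((A `&` B2) `|` (A `&` B3)).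
  apply: measureU; [exact: measurableI|by apply: measurableU; exact: measurableI|].
  apply/seteqP; split=> // t [[_ /= h1]] [] [_ /=]; last by case.
  by move=> h2; have : (x - 1 = x + 1)%R := etrans (esym h1) h2; clear; lia.
have e2 : Q ((A `&` B2) `|` (A `&` B3)) = Q (A `&` B2) + Q (A `&` B3).
  apply: measureU; [exact: measurableI|exact: measurableI|].
  by apply/seteqP; split=> // t [[_ /= h1]] [_ /= [_]].
rewrite eA e1 e2.
rewrite B30 adde0 !(markov_step Qfin chain) !IH walk_prob_forward /walk_transition.
rewrite subrK eqxx (_ : (x == x + 1 + 1)%R = false); last by apply/eqP; lia.
by rewrite addrK eqxx -!EFinM -EFinD.
Qed.

End CountablePartition.

(** * Reduction to uniformly elliptic environments *)

Section EllipticTail.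
Context d (T : measurableType d) (R : realType) (P : probability T R).
Variables (omega : int -> {RV P >-> R}) (e : R).
Hypotheses (e0 : 0 < e) (e2 : e < 1 / 2).
Hypothesis omega01 : forall x t, 0 < omega x t < 1.
Hypothesis omega_iid : iid omega.
Hypothesis elliptic : P [set t | e <= omega 0 t <= 1 - e] = 1%E.
Hypothesis recurrent : ('E_P[fun t => ln (rho (omega 0%R t))] = 0)%E.
Hypothesis nondegenerate : (0 < 'E_P[fun t => (ln (rho (omega 0%R t)) ^+ 2)%R])%E.

(* Clamping changes nothing almost surely and makes the environment uniformly
   elliptic everywhere. *)
Let clamp (a : R) := Num.max e (Num.min a (1 - e)).

Let clamp_bounds a : e <= clamp a <= 1 - e.
Proof.
have he := e2; rewrite /clamp le_max lexx /= ge_max ge_min lexx orbT andbT.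
lra.
Qed.

Let clamp_id a : e <= a <= 1 - e -> clamp a = a.
Proof. by move=> /andP[h1 h2]; rewrite /clamp (min_idPl h2) (max_idPr h1). Qed.

Let mclamp : measurable_fun setT clamp.
Proof. by apply: measurable_maxr => //; exact: measurable_minr. Qed.

Let eta x t := clamp (omega x t).

Let etae x t : e <= eta x t <= 1 - e.
Proof. exact: clamp_bounds. Qed.

Let meta x : measurable_fun setT (eta x).
Proof. exact: (measurableT_comp mclamp (@measurable_funPT _ _ _ _ (omega x))). Qed.

Let phi (a : R) := ln (rho (clamp a)).

Let clamp01 a : 0 < clamp a < 1.
Proof. by have /andP[h1 h2] := clamp_bounds a; have he := e0; apply/andP; split; lra. Qed.

Let mphi : measurable_fun setT phi.
Proof.
rewrite (_ : phi = fun a => ln (1 - clamp a) - ln (clamp a)).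
  apply: measurable_funB; apply: (measurableT_comp (@measurable_ln R)) => //.
  exact: measurable_funB.
by apply/funext => a; rewrite /phi ln_rhoE.
Qed.

Let bphi a : `|phi a| <= - ln e.
Proof. exact: ln_rho_bound. Qed.

Let bddm_comp x (f : R -> R) : measurable_fun setT f -> (exists M, forall a, `|f a| <= M) ->
  bddm (fun t => f (omega x t)).
Proof.
move=> mf [M hM]; split; last by exists M.
exact: (measurableT_comp mf (@measurable_funPT _ _ _ _ (omega x))).
Qed.

Let same_law x (f : R -> R) : measurable_fun setT f -> (exists M, forall a, `|f a| <= M) ->
  Ex P (fun t => f (omega x t)) = Ex P (fun t => f (omega 0 t)).
Proof.
move=> mf bf; rewrite /Ex /Rintegral; congr fine.
have mEf : measurable_fun setT (EFin \o f) by exact/measurable_EFinP.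
have key y : (\int[P]_t (f (omega y t))%:E = \int[distribution P (omega y)]_a (f a)%:E)%E.
  have iy : P.-integrable (omega y @^-1` setT) ((EFin \o f) \o omega y).
    by rewrite preimage_setT; apply: bddm_integrable; exact: bddm_comp.
  by rewrite (@integral_pushforward _ _ _ _ _ (omega y) (@measurable_funPT _ _ _ _ (omega y)) P
    setT (EFin \o f) mEf iy measurableT) preimage_setT.
rewrite !key; apply: eq_measure_integral => A mA _.
by have [_] := omega_iid; apply.
Qed.

Let elliptic_set x := [set t | e <= omega x t <= 1 - e].

Let melliptic x : measurable (elliptic_set x).
Proof.
rewrite (_ : elliptic_set x = omega x @^-1` `[e, 1 - e]%classic); last first.
  by apply/seteqP; split=> t /=; rewrite in_itv.
by rewrite -[X in measurable X]setTI; apply: (@measurable_funPT _ _ _ _ (omega x)).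
Qed.

Let elliptic_all x : P (~` elliptic_set x) = 0%E.
Proof.
have e1 y : elliptic_set y = omega y @^-1` `[e, 1 - e]%classic.
  by apply/seteqP; split=> t /=; rewrite in_itv.
rewrite probability_setC // -/(elliptic_set x).
have -> : P (elliptic_set x) = P (elliptic_set 0).
  rewrite !e1; have [_ h] := omega_iid; exact: (h x 0 _ (measurable_itv _)).
by rewrite elliptic subee.
Qed.

Let ae_clamp (f : R -> R) : measurable_fun setT (fun t => f (omega 0 t)) ->
  measurable_fun setT (fun t => f (clamp (omega 0 t))) ->
  (\int[P]_t (f (clamp (omega 0 t)))%:E = \int[P]_t (f (omega 0 t))%:E)%E.
Proof.
move=> m1 m2; apply: ae_eq_integral => //; [exact/measurable_EFinP|exact/measurable_EFinP|].
exists (~` elliptic_set 0); split; [exact: measurableC|exact: elliptic_all|].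
by move=> t /= h ht; apply: h => _; rewrite clamp_id.
Qed.

Let mlr : measurable_fun setT (fun t => ln (rho (omega 0 t))).
Proof.
rewrite (_ : (fun t => _) = fun t => ln (1 - omega 0 t) - ln (omega 0 t)).
  apply: measurable_funB; apply: (measurableT_comp (@measurable_ln R)) => //.
  exact: measurable_funB.
by apply/funext => a; rewrite ln_rhoE.
Qed.

Let bphi2 : exists M, forall a, `|phi a ^+ 2| <= M.
Proof.
exists ((- ln e) ^+ 2) => a; rewrite normrX ler_sqr ?nnegrE //.
by apply: le_trans (bphi a).
Qed.

Let mphi2 : measurable_fun setT (fun a => phi a ^+ 2).
Proof. exact: measurable_funX. Qed.

Let eta_mean x : Ex P (fun t => ln (rho (eta x t))) = 0.
Proof.
rewrite (same_law x mphi); last by exists (- ln e).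
rewrite /Ex /Rintegral (@ae_clamp (fun a => ln (rho a))) //; last first.
  exact: (measurableT_comp mphi (@measurable_funPT _ _ _ _ (omega 0))).
by move: recurrent; rewrite unlock => ->.
Qed.

Let s2 := Ex P (fun t => phi (omega 0 t) ^+ 2).

Let eta_var x : Ex P (fun t => ln (rho (eta x t)) ^+ 2) = s2.
Proof. exact: (same_law x mphi2 bphi2). Qed.

Let s20 : 0 < s2.
Proof.
have h : (s2%:E = \int[P]_t (phi (omega 0 t) ^+ 2)%:E)%E.
  rewrite /s2 /Ex /Rintegral fineK //.
  exact: integrable_fin_num (bddm_integrable P (bddm_comp 0 mphi2 bphi2)).
rewrite -lte_fin h (@ae_clamp (fun a => ln (rho a) ^+ 2)).
- by move: nondegenerate; rewrite unlock.
- exact: measurable_funX.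
- exact: (measurableT_comp mphi2 (@measurable_funPT _ _ _ _ (omega 0))).
Qed.

Let eta_indep : independent P setT (fun x => preimage_set_system setT (eta x) measurable).
Proof.
have [hi _] := omega_iid => J A JT hA; apply: hi => // k kJ.
have [B mB <-] := hA k kJ; exists (clamp @^-1` B); last by rewrite !setTI.
by rewrite -[X in measurable X]setTI; exact: mclamp.
Qed.

Lemma elliptic_walk_prob_tail eps : 0 < eps -> exists C n0, 0 < C /\ forall n, (n0 <= n)%N ->
  1 < ln n%:R :> R /\ forall x,
  fine (P [set t | C / ln n%:R ^+ 2 < walk_prob (fun y => omega y t) n x 0]) <=
    C / ln n%:R ^+ 2 * ln n%:R `^ eps.
Proof.
move=> eps0.
have [C [n0 [C0 h]]] := walk_prob_tail e0 s20 meta etae eta_indep eta_mean eta_var eps0.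
exists C, n0; split=> // n /h[h1 h2]; split=> // x; apply: le_trans (h2 x).
set c := C / _.
have mS (z : int -> T -> R) : (forall y, measurable_fun setT (z y)) ->
    measurable [set t | c < walk_prob (z^~ t) n x 0].
  move=> mz; have := measurable_walk_prob n x 0 mz measurableT (measurable_itv `]c, +oo[).
  rewrite setTI (_ : _ @^-1` _ = [set t | c < walk_prob (z^~ t) n x 0]) //.
  by apply/seteqP; split=> t /=; rewrite in_itv /= andbT.
have m1 := mS _ (fun y => @measurable_funPT _ _ _ _ (omega y)).
have m2 := mS _ meta.
(* The union of countably many null sets: outside it all sites are elliptic at once, and clamping
   leaves the whole environment unchanged. *)
have [N [mN N0 subN]] : P.-negligible (\bigcup_i
    [set t | exists2 y : int, choice.pickle y = i & (~` elliptic_set y) t]).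
  apply: negligible_bigcup => i.
  have [[y hy]|hy] := pselect (exists y : int, choice.pickle y = i).
    exists (~` elliptic_set y); split; [exact: measurableC|exact: elliptic_all|].
    by move=> t [y' hy'] ; rewrite (pcan_inj choice.pickleK (etrans hy' (esym hy))).
  rewrite (_ : [set t | _] = set0); first exact: negligible_set0.
  by apply/seteqP; split=> // t [y hy' _]; apply: hy; exists y.
rewrite fine_le ?fin_num_measure //.
apply: (@le_trans _ _ (P ([set t | c < walk_prob (eta^~ t) n x 0] `|` N))).
  apply: le_measure; rewrite ?inE //; first exact: measurableU.
  move=> t /= ht; have [hN|hN] := pselect (N t); first by right.
  left; rewrite (_ : eta^~ t = fun y => omega y t) //; apply/funext => y.
  apply: clamp_id; apply: contrapT => hy; apply: hN; apply: subN.
  by exists (choice.pickle y) => //; exists y.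
set A := [set t | _]; have : (P (A `|` N) <= P A + P N)%E by exact: measureU2.
by rewrite N0 adde0.
Qed.

End EllipticTail.

Lemma independent_pair d (T : measurableType d) (R : realType)
    (Q : {measure set T -> \bar R}) (K : choiceType) (D : set K)
    (F : K -> set (set T)) i j A B : independent Q D F -> i != j -> D i -> D j ->
  F i A -> F j B -> Q (A `&` B) = (Q A * Q B)%E.
Proof.
move=> h ij Di Dj FA FB.
pose J := [fset i; j]%fset; pose C k := if k == i then A else B.
have Ci : C i = A by rewrite /C eqxx.
have Cj : C j = B by rewrite /C eq_sym (negbTE ij).
have JD : [set` J] `<=` D by move=> k /=; rewrite !inE => /orP[] /eqP ->.
have CF k : k \in J -> F k (C k) by rewrite !inE => /orP[] /eqP ->; rewrite ?Ci ?Cj.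
have := h J C JD CF; rewrite /J big_fsetU1 ?inE // big_seq_fset1 Ci Cj => <-.
congr (Q _); apply/seteqP; split=> t.
  by move=> [At Bt] k /=; rewrite !inE => /orP[] /eqP ->; rewrite ?Ci ?Cj.
move=> ht; have := ht i; have := ht j; rewrite /= Ci Cj !inE !eqxx orbT.
by move=> /(_ isT) ? /(_ isT).
Qed.

(** * Collisions of two walks in independent environments *)

Section Collision.
Context d d' (Omega : measurableType d) (W : measurableType d') (R : realType).
Variables (P : probability Omega R) (Pq : R.-pker Omega ~> W).
Variables (w1 w2 : int -> {RV P >-> R}) (Z1 Z2 : nat -> {mfun W >-> int}).
Hypothesis w1_01 : forall x t, 0 < w1 x t < 1.
Hypothesis w2_01 : forall x t, 0 < w2 x t < 1.
Hypothesis w12_indep : forall A B, sigma_generated w1 A -> sigma_generated w2 B ->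
  P (A `&` B) = (P A * P B)%E.
Hypothesis chain1 : forall t, markov_chain (Pq t) (walk_transition (w1^~ t)) 0 (Z1).
Hypothesis chain2 : forall t, markov_chain (Pq t) (walk_transition (w2^~ t)) 0 (Z2).
Hypothesis Z12_indep : forall t A B, sigma_generated Z1 A -> sigma_generated Z2 B ->
  Pq t (A `&` B) = (Pq t A * Pq t B)%E.

Variables (n : nat) (delta q : R).
Hypothesis delta0 : 0 <= delta.
Hypothesis tail : forall x,
  fine (P [set t | delta < walk_prob (fun y => w1 y t) n x 0]) <= q.

Let p1 x t := walk_prob (fun y => w1 y t) n x 0.
Let p2 x t := walk_prob (fun y => w2 y t) n x 0.

Let generated_walk_prob (w : int -> {RV P >-> R}) x :
  measurable_fun setT ((fun t => walk_prob (fun y => w y t) n x 0) :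
    g_sigma_algebraType (\bigcup_k preimage_set_system setT (w k) measurable) -> R).
Proof.
set G := \bigcup_k _; pose T' : measurableType G.-sigma := g_sigma_algebraType G.
apply: (@measurable_walk_prob _ T' R (fun y t => w y t)) => y _ B mB.
by apply: sub_sigma_algebra; exists y => //; exists B.
Qed.

Let bddm_walk_prob (w : int -> {RV P >-> R}) x : (forall x t, 0 < w x t < 1) ->
  bddm (fun t => walk_prob (fun y => w y t) n x 0).
Proof.
move=> w01; split.
  by apply: (measurable_walk_prob (eta := fun y t => w y t)) => z; exact: measurable_funPT.
by exists 1 => t; rewrite ger0_norm ?walk_prob_ge0 ?walk_prob_le1.
Qed.

(** [p1 x] is at most [\1_D + delta], and [D] is an event of the first environment, so its
    probability factors out. [Ex P (p2 x)] is kept on the right for the sum over [x]. *)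
Lemma collision_site_le x :
  Ex P (fun t => p1 x t * p2 x t) <= (q + delta) * Ex P (p2 x).
Proof.
pose D := [set t | delta < p1 x t].
have b1 : bddm (p1 x) by exact: bddm_walk_prob.
have b2 : bddm (p2 x) by exact: bddm_walk_prob.
have eD : D = p1 x @^-1` `]delta, +oo[%classic.
  by apply/seteqP; split=> t /=; rewrite in_itv /= andbT.
have sD : sigma_generated w1 D.
  have := @generated_walk_prob w1 x measurableT _ (measurable_itv `]delta, +oo[).
  by rewrite setTI -eD.
have mD : measurable D.
  by rewrite eD -[X in measurable X]setTI; case: b1 => m1 _; apply: m1.
have p20 t : 0 <= p2 x t by exact: walk_prob_ge0.
have bD2 : bddm (fun t => \1_D t * p2 x t) by apply: bddmM => //; exact: bddm_indic.
have bd2 : bddm (fun t => delta * p2 x t) by apply: bddmM => //; exact: bddm_cst.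
apply: (@le_trans _ _ (Ex P (fun t => \1_D t * p2 x t + delta * p2 x t))).
  apply: le_Ex; [exact: bddmM|exact: bddmD|] => t; rewrite -mulrDl.
  apply: ler_wpM2r => //; have [hD|hD] := leP (p1 x t) delta.
    by apply: ler_wpDl => //; rewrite indicE.
  rewrite indicE mem_set // ler_wpDr // /p1; exact: walk_prob_le1.
rewrite ExD // ExZ // (@ExM_independent _ _ _ P (sigma_generated w1) (sigma_generated w2)) //.
- rewrite Ex_indic // -mulrDl; apply: ler_wpM2r.
    by rewrite -(Ex_cst P 0); apply: le_Ex => //; exact: bddm_cst.
  by rewrite lerD2r; exact: tail.
- exact: bddm_indic.
- pose G := \bigcup_k preimage_set_system setT (w1 k) measurable.
  pose T' : measurableType G.-sigma := g_sigma_algebraType G.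
  move=> B mB; have mI : measurable_fun setT (\1_D : T' -> R) by exact: measurable_indic.
  by have := mI measurableT B mB; rewrite setTI.
- by move=> B mB; have := @generated_walk_prob w2 x measurableT _ mB; rewrite setTI.
Qed.

Let B i : set int := [set x | choice.pickle x = i].

Let sgen (Z : nat -> {mfun W >-> int}) C : sigma_generated Z (Z n @^-1` C).
Proof. by apply: sub_sigma_algebra; exists n => //; exists C; rewrite ?setTI. Qed.

Let collision_sites : [set t | Z1 n t = Z2 n t] =
  \bigcup_i (Z1 n @^-1` B i `&` Z2 n @^-1` B i).
Proof.
apply/seteqP; split=> t /=.
  by move=> e; exists (choice.pickle (Z1 n t)) => //; split=> //=; rewrite e.
by move=> [i _ [h1 h2]]; apply: (pcan_inj choice.pickleK); exact: etrans h1 (esym h2).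
Qed.

Let siteP i : (exists x : int, B i = [set x]) \/ B i = set0.
Proof.
have [[x hx]|hx] := pselect (exists x : int, choice.pickle x = i); [left|right].
  exists x; apply/seteqP; split=> y /=; last by move=> ->.
  by move=> hy; apply: (pcan_inj choice.pickleK); exact: etrans hy (esym hx).
by apply/seteqP; split=> // y hy; apply: hx; exists y.
Qed.

Lemma annealed_collision_le :
  (annealed P Pq [set t | Z1 n t = Z2 n t] <= (q + delta)%:E)%E.
Proof.
have q0 : 0 <= q by apply: le_trans (tail 0); exact: fine_ge0.
have mB (Z : nat -> {mfun W >-> int}) i : measurable (Z n @^-1` B i) by exact: preimage_int.
have mC : measurable [set t | Z1 n t = Z2 n t].
  by rewrite collision_sites; apply: bigcup_measurable => i _; exact: measurableI.
have split_sites t : (Pq t [set s | Z1 n s = Z2 n s] =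
    \sum_(0 <= i <oo) (Pq t (Z1 n @^-1` B i) * Pq t (Z2 n @^-1` B i)))%E.
  rewrite (measure_int_partition (Pq t) (Z1 n) mC); apply: eq_eseriesr => i _.
  rewrite -Z12_indep; [|exact: sgen|exact: sgen].
  congr (Pq t _); apply/seteqP; split=> s [h1 h2].
    by split=> //=; rewrite -h1.
  by split=> //=; apply: (pcan_inj choice.pickleK); exact: etrans h1 (esym h2).
have meas (Z : nat -> {mfun W >-> int}) i : measurable_fun setT (fun t => Pq t (Z n @^-1` B i)).
  exact: measurable_kernel.
rewrite /annealed (eq_integral _ _ (fun t _ => split_sites t)).
rewrite integral_nneseries; [|by []|by move=> i; exact: emeasurable_funM|]; last first.
  by move=> i t _; exact: mule_ge0.
have law1 x t : Pq t (Z1 n @^-1` [set x]) = (p1 x t)%:E.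
  exact: (walk_law n x (prob_kernel t) (chain1 t)).
have law2 x t : Pq t (Z2 n @^-1` [set x]) = (p2 x t)%:E.
  exact: (walk_law n x (prob_kernel t) (chain2 t)).
apply: (@le_trans _ _
  (\sum_(0 <= i <oo) ((q + delta)%:E * \int[P]_t Pq t (Z2 n @^-1` B i)))%E).
  apply: lee_nneseries => i _; first by move=> _; apply: integral_ge0 => t _; exact: mule_ge0.
  have [[x ->]|->] := siteP i; last first.
    under eq_integral do rewrite preimage_set0 measure0 mul0e.
    by rewrite integral0 mule_ge0 ?lee_fin ?addr_ge0 // integral_ge0.
  have b1 : bddm (p1 x) by exact: bddm_walk_prob.
  have b2 : bddm (p2 x) by exact: bddm_walk_prob.
  have ExE f : bddm f -> (\int[P]_t (f t)%:E = (Ex P f)%:E)%E.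
    by move=> bf; rewrite /Ex /Rintegral fineK //; exact: integrable_fin_num (bddm_integrable P bf).
  rewrite (eq_integral (fun t => (p1 x t * p2 x t)%:E)); last first.
    by move=> t _; rewrite EFinM -law1 -law2.
  rewrite [X in (_ <= _ * X)%E](eq_integral (fun t => (p2 x t)%:E)); last first.
    by move=> t _; rewrite -law2.
  rewrite ExE ?ExE //; last exact: bddmM.
  by rewrite -EFinM lee_fin; exact: collision_site_le.
(* What remains is the sum over sites of the laws of [Z2 n], of total mass one. *)
rewrite nneseriesZl; last by move=> i _; exact: integral_ge0.
rewrite -integral_nneseries //.
rewrite (eq_integral (fun=> 1%E)); last first.
  move=> t _; rewrite -(prob_kernel (s := Pq) t) (measure_int_partition (Pq t) (Z2 n) measurableT).
  by apply: eq_eseriesr => i _; rewrite setTI.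
have PT : (P : {measure set Omega -> \bar R}) setT = 1%E by exact: probability_setT.
by rewrite integral_cst ?mul1e // PT mule1.
Qed.

End Collision.

Theorem proposition1p4 (R : realType) (d d' : measure_display)
    (Omega : measurableType d) (P : probability Omega R)
    (W : measurableType d') (r I : nat)
    (omega : 'I_r -> int -> {RV P >-> R}) (eps0 : R)
    (Pq : R.-pker Omega ~> W) (Z : 'I_r -> nat -> {mfun W >-> int})
    (hI : (2 <= I)%N) (hr : (I <= r)%N)
    (omega01 : forall j x w, 0 < omega j x w < 1)
    (omega_iid : forall j, iid (omega j))
    (omega_indep : independent P [set j : 'I_r | (j < I)%N]
       (fun j => sigma_generated (omega j)))
    (omega_copy : forall j : 'I_r, (I <= j)%N ->
       exists2 i : 'I_r, (i < I)%N & forall x w, omega j x w = omega i x w)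
    (heps0 : 0 < eps0 < 1 / 2)
    (elliptic : forall j,
       P [set w | eps0 <= omega j 0 w <= 1 - eps0] = 1%E)
    (recurrent : forall j, ('E_P[fun w => ln (rho (omega j 0%R w))] = 0)%E)
    (nondegenerate : forall j,
       (0 < 'E_P[fun w => (ln (rho (omega j 0 w)) ^+ 2)%R])%E)
    (quenched : forall w,
       quenched_law (fun j x => omega j x w) Z (Pq w))
    (j1 j2 : 'I_r) (hj1 : j1 = 0%N :> nat) (hj2 : j2 = 1%N :> nat)
    (eps : R) (heps : 0 < eps) :
  (fun n : nat => fine (annealed P Pq [set t | Z j1 n t = Z j2 n t]))
    =O_\oo (fun n : nat => ln n%:R `^ (- 2 + eps)).
Proof.
have j12 : j1 != j2 by apply/eqP => e; move: hj1; rewrite e hj2.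
have /andP[e0 e2] := heps0.
have [C [n0 [C0 hC]]] := elliptic_walk_prob_tail e0 e2 (omega01 j1) (omega_iid j1)
  (elliptic j1) (recurrent j1) (nondegenerate j1) heps.
have w12 A B : sigma_generated (omega j1) A -> sigma_generated (omega j2) B ->
    P (A `&` B) = (P A * P B)%E.
  by apply: independent_pair omega_indep j12 _ _ => /=; rewrite ?hj1 ?hj2 // ltnW.
have Z12 w A B : sigma_generated (Z j1) A -> sigma_generated (Z j2) B ->
    Pq w (A `&` B) = (Pq w A * Pq w B)%E.
  by have [_ h] := quenched w; exact: independent_pair h j12 Logic.I Logic.I.
apply/eqO_exP; exists (2 * C); first by rewrite mulr_gt0.
near=> n.
have /hC[l1 tail] : (n0 <= n)%N by near: n; exact: nbhs_infty_ge.
move: l1 tail; set l := ln n%:R => l1 tail; set c := C / l ^+ 2 in tail.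
have l0 : 0 < l by apply: lt_trans l1.
have c0 : 0 <= c by rewrite divr_ge0 ?ltW // exprn_gt0.
have := @annealed_collision_le _ _ _ _ _ P Pq (omega j1) (omega j2) (Z j1) (Z j2)
  (omega01 j1) (omega01 j2) w12 (fun w => (quenched w).1 j1) (fun w => (quenched w).1 j2)
  Z12 n c (c * l `^ eps) c0 tail.
set a := annealed _ _ _ => ha.
have a0 : (0 <= a)%E by apply: integral_ge0 => t _; exact: measure_ge0.
have afin : a \is a fin_num by rewrite ge0_fin_numE // (le_lt_trans ha) ?ltry.
rewrite ger0_norm ?fine_ge0 // ger0_norm ?powR_ge0 //.
apply: (@le_trans _ _ (c * l `^ eps + c)); first by rewrite -lee_fin fineK.
(* As [l > 1], the threshold [c] is at most the tail term, which explains the constant [2 * C]. *)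
have pe : 1 <= l `^ eps by rewrite -(powRr0 l) ler_powR ?ltW.
have -> : l `^ (- 2 + eps) = (l ^+ 2)^-1 * l `^ eps.
  by rewrite powRD ?(lt0r_neq0 l0) ?implybT // powR_invn // ltW.
have -> : 2 * C * ((l ^+ 2)^-1 * l `^ eps) = c * l `^ eps + c * l `^ eps.
  by rewrite /c; ring.
by rewrite lerD2l -[leLHS]mulr1 ler_wpM2l.
Unshelve. all: by end_near.
Qed.
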